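(* Let $n\ge1$, and for a positive integer $N=2^{l}(2s+1)$ with integers $l,s\ge0$ put $\mu_N=h_l(0)$ if $s=0$ and $\mu_N=h_l(0)\star(2,1^{2(s-1)})$ if $s>0$. Consider the following procedure, which builds a string of sequences. Write $n=2^l(2s+1)$ and start with the string $h_0(0)=(0),\,h_1(0),\dots,h_l(0),\,\mu_n$ (where $\mu_n=h_l(0)$ is listed only once if $s=0$), and let $\alpha=\mu_n$. As long as $\alpha$ is not $(n-1)$, do the following: (a) obtain $\alpha'\in L_n$ by applying one elementary operation $\mathcal{E}_s$ or $\mathcal{E}_c$ on the tail of the longest left sequence of $\alpha$ of even length which gives a lexical successor in $L_n$ (that is, on cell $i$ of $\alpha$, where $i$ is the largest even index for which the elementary operation on cell $i$ yields an element of $L_n$); (b) compute $f=\alpha\wedge\alpha'\in L_m$ and divide $n=dm+r$, $0\le r<m$; (c) if $r>0$, append $\alpha'$ to the string and replace $\alpha$ by $\alpha'$; if $r=0$, write $d=2^k(2t+1)$, append $f,\,h_1(f),\dots,h_k(f),\,f\star\mu_d$ to the string (where $f\star\mu_d=h_k(f)$ is listed only once if $t=0$) and replace $\alpha$ by $f\star\mu_d$. Then the procedure ends at the maximal element $(n-1)$ of $D_n$, and the resulting string consists of all elements of $D_n$ in increasing order, each one adjacent in $D_n$ to the next one.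
   Context: An $\alpha$-sequence is a finite sequence $\alpha=(\alpha_1,\dots,\alpha_k)$ of positive integers; in addition the one-term sequence $(0)$ is admitted. Its length is $l(\alpha)=k$ and its degree is $D(\alpha)=\sum_{i=1}^k\alpha_i$. A left sequence of $\alpha$ is $(\alpha_1,\dots,\alpha_i)$, $1\le i\le k$, and its tail is $\alpha_i$. Order. For $\tau=(\tau_1,\dots,\tau_k)$ put $Al(\tau)=(\tau_1,-\tau_2,\tau_3,\dots,(-1)^{k-1}\tau_k,0,0,\dots)$. For $\tau\ne\tau'$ write $\tau>\tau'$ if the first nonzero term of $Al(\tau)-Al(\tau')$ is positive, and $\tau<\tau'$ if it is negative. This is a total order. If $\alpha<\beta$, $\beta$ is called a successor of $\alpha$. For elements of a set $S$, ''$\alpha$ is adjacent to $\beta$ in $S$'' means $\alpha<\beta$ and there is no $\gamma\in S$ with $\alpha<\gamma<\beta$. A sequence $\alpha=(\alpha_1,\dots,\alpha_k)$ is lexical if $\alpha>(\alpha_i,\dots,\alpha_k)$ for all $2\le i\le k$. $L_n$ is the set of lexical sequences $\alpha$ with $1+D(\alpha)=n$; in particular $L_1=\{(0)\}$. $D_n=\bigcup_{d\mid n}L_d$. Elementary operations. The $i$-th place of $\alpha$ is called its $i$-th cell, with value $\alpha_i$. The elementary operation on cell $i$ is: if $\alpha_i>1$, splitting $\mathcal{E}_s$, which gives $(\alpha_1,\dots,\alpha_{i-1},\alpha_i-1,1,\alpha_{i+1},\dots,\alpha_k)$; if $\alpha_i=1$ (and $i\ge2$), conjugation $\mathcal{E}_c$,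 which gives $(\alpha_1,\dots,\alpha_{i-2},\alpha_{i-1}+1,\alpha_{i+1},\dots,\alpha_k)$. Wedge. $\alpha\wedge\alpha=\alpha$; for $\alpha\ne\beta$, if $i$ is the first place with $\alpha_i\neq\beta_i$, then $\alpha\wedge\beta=(\alpha_1,\dots,\alpha_{i-1},\min(\alpha_i,\beta_i))$. Products and harmonics. $\alpha\beta$ is concatenation, $\alpha^q$ is $\alpha$ repeated $q$ times ($\alpha^0$ is empty), and $1^q$ means $1$ repeated $q$ times. For $\alpha=(\alpha_1,\dots,\alpha_k)$: if $k$ is even, $\alpha_e=(\alpha_1,\dots,\alpha_k+1)$ and $\alpha_o=(\alpha_1,\dots,\alpha_k,1)$; if $k$ is odd, $\alpha_e=(\alpha_1,\dots,\alpha_k,1)$ and $\alpha_o=(\alpha_1,\dots,\alpha_k+1)$. The star product of $\alpha$ and $\beta=(\beta_1,\dots,\beta_k)$ is $\alpha\star\beta=\alpha_o(\alpha_e)^{\beta_1-1}\alpha_o(\alpha_e)^{\beta_2-1}\cdots\alpha_o(\alpha_e)^{\beta_k-1}\alpha$, with the convention $(0)\star\beta=\beta$. The harmonics of a sequence $\alpha$ are $h_0(\alpha)=\alpha$ and $h_j(\alpha)=(h_{j-1}(\alpha))_o\,h_{j-1}(\alpha)$ for $j\ge1$, with the convention $h_1(0)=(1)$ for $\alpha=(0)$; so $h_2(0)=(2,1)$, $h_3(0)=(2,1,1,2,1)$. *)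

(* Defs.v *)
From HB Require Import structures.
From mathcomp Require Import all_boot all_order all_algebra.

Set Implicit Arguments.
Unset Strict Implicit.
Unset Printing Implicit Defensive.

Import Order.TTheory GRing.Theory Num.Theory.

(* Sequences are [seq nat] and cells are numbered from 1, so that the value of *)
(* the i-th cell of [a] is [nth 0 a i.-1].                                     *)

Definition alpha_seq (a : seq nat) : bool :=
  (a == [:: 0]) || (a != [::]) && all (leq 1) a.

(* The i-th term, now counted from 0, of the infinite sequence Al(a). *)
Definition Al (a : seq nat) (i : nat) : int :=
  ((-1) ^+ i * (nth 0%N a i)%:Z)%R.

(* The first nonzero term of Al(a) - Al(b) is negative.  Both Al(a) and Al(b)  *)
(* vanish from [maxn (size a) (size b)] on.                                    *)
Definition seq_lt (a b : seq nat) : bool :=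
  has (fun i => (Al a i < Al b i)%R && all (fun j => Al a j == Al b j) (iota 0 i))
      (iota 0 (maxn (size a) (size b))).

Definition lexical (a : seq nat) : bool :=
  all (fun i => seq_lt (drop i.-1 a) a) (iota 2 (size a).-1).

Definition L (n : nat) : {pred seq nat} :=
  [pred a | [&& alpha_seq a, lexical a & 1 + sumn a == n]].

Definition D (n : nat) : {pred seq nat} :=
  [pred a | has (fun d => a \in L d) (divisors n)].

Definition adjacent_in (X : {pred seq nat}) (a b : seq nat) : Prop :=
  seq_lt a b /\ ~ exists c, [/\ c \in X, seq_lt a c & seq_lt c b].

Definition maximal_in (X : {pred seq nat}) (a : seq nat) : Prop :=
  a \in X /\ forall b, b \in X -> b <> a -> seq_lt b a.

(* [None] when no elementary operation is defined on cell [i]. *)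
Definition elementary_op (i : nat) (a : seq nat) : option (seq nat) :=
  let x := nth 0 a i.-1 in
  if (0 < i) && (1 < x) then Some (take i.-1 a ++ [:: x.-1; 1] ++ drop i a)
  else if (1 < i) && (x == 1) then Some (incr_nth (take i.-1 a) i.-2 ++ drop i a)
  else None.

(* If one sequence is a left sequence of the other, the result is the shorter  *)
(* one; this never happens for distinct elements of the same [L n].            *)
Fixpoint wedge (a b : seq nat) : seq nat :=
  match a, b with
  | x :: a', y :: b' => if x == y then x :: wedge a' b' else [:: minn x y]
  | _, _ => [::]
  end.

Definition incr_tail (a : seq nat) : seq nat := incr_nth a (size a).-1.

Definition seq_e (a : seq nat) : seq nat :=
  if odd (size a) then rcons a 1 else incr_tail a.

Definition seq_o (a : seq nat) : seq nat :=
  if odd (size a) then incr_tail a else rcons a 1.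

(* Only meant for [b] with positive terms, unless [a] is [:: 0]. *)
Definition star (a b : seq nat) : seq nat :=
  if a == [:: 0] then b
  else flatten [seq seq_o a ++ flatten (nseq x.-1 (seq_e a)) | x <- b] ++ a.

Fixpoint harmonic (j : nat) (a : seq nat) : seq nat :=
  if j is j'.+1 then
    let b := harmonic j' a in if b == [:: 0] then [:: 1] else seq_o b ++ b
  else a.

(* The unique l and s such that N = 2 ^ l * (2 * s + 1), for N > 0. *)
Definition two_exp (N : nat) : nat := logn 2 N.
Definition half_odd (N : nat) : nat := (N %/ 2 ^ two_exp N)./2.

Lemma two_expE (N l s : nat) :
  N = 2 ^ l * (2 * s + 1) -> two_exp N = l /\ half_odd N = s.
Proof.
move=> ->; have El : two_exp (2 ^ l * (2 * s + 1)) = l.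
  rewrite /two_exp lognM ?expn_gt0 ?addn1 // pfactorK //.
  by rewrite lognE dvdn2 /= mul2n odd_double addn0.
by rewrite /half_odd El mulKn ?expn_gt0 // addn1 mul2n /= uphalf_double.
Qed.

Definition mu (N : nat) : seq nat :=
  let h := harmonic (two_exp N) [:: 0] in
  let s := half_odd N in
  if s == 0 then h else star h (2 :: nseq (2 * (s - 1)) 1).

(* h_0(f), ..., h_k(f), f * mu_d, where d = 2 ^ k * (2 * t + 1), the last one  *)
(* being omitted if t = 0.                                                     *)
Definition block (f : seq nat) (d : nat) : seq (seq nat) :=
  [seq harmonic j f | j <- iota 0 (two_exp d).+1]
    ++ (if half_odd d == 0 then [::] else [:: star f (mu d)]).

(* The largest even cell on which the elementary operation yields an element   *)
(* of L_n, or 0 if there is none.                                              *)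
Definition active_cell (n : nat) (a : seq nat) : nat :=
  last 0 [seq i <- iota 1 (size a) |
            ~~ odd i && oapp (mem (L n)) false (elementary_op i a)].

(* The string built so far and the current sequence. *)
Definition state : Type := seq (seq nat) * seq nat.

(* [star [:: 0] (mu n)] is [mu n]. *)
Definition start (n : nat) : state := (block [:: 0] n, mu n).

(* One passage through (a), (b), (c).  The result is [None] if the procedure   *)
(* has ended, and also if it cannot go on, because (a) is impossible or [f] is *)
(* not lexical.                                                                *)
Definition step (n : nat) (st : state) : option state :=
  let: (str, a) := st in
  if a == [:: n.-1] then None
  else if elementary_op (active_cell n a) a is Some a' then
    let f := wedge a a' in
    let m := 1 + sumn f in
    if f \notin L m then None
    else if 0 < n %% m then Some (rcons str a', a')
    else let d := n %/ m in Some (str ++ block f d, star f (mu d))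
  else None.

Definition run (n N : nat) : option state :=
  iter N (obind (step n)) (Some (start n)).

(* Main.v *)
(* Read a sequence as the word 1^{a_1} 0^{a_2} 1^{a_3} ... over {0, 1}: the    *)
(* order becomes lexicographic, and a sequence is lexical iff its word t is    *)
(* larger than all its proper suffixes and their complements (an end marker    *)
(* lies between 0 and 1).  To a lexical word z attach the periodic words       *)
(* z^- = (z 0)^oo and z^+ = (z 1 ~z 0)^oo; both are maximal among their own    *)
(* shifts and complemented shifts, z^- < z^+, and z < z' implies z^+ <= z'^-.  *)
(* Conversely the largest signed shift of a non constant word of period n is   *)
(* z^- for some z in D_n.  Hence if n / |z| is odd, with |z| the level of z,   *)
(* and x follows z in D_n, then z^+ and x^- agree up to some place, where z^+  *)
(* has a 0, and are complementary from there to n.  For z of level n this says *)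
(* that x is obtained by one flip (an elementary operation) or is the prefix   *)
(* before the flip; for n / |z| = 2 s + 1 > 1 it says                          *)
(* x = z * (2, 1^{2 (s - 1)}).  If n / |z| is even the next element is h_1(z), *)
(* since h_1(z)^- = z^+ leaves no room between z and h_1(z).                   *)

Require Import Defs.
From mathcomp Require Import all_boot all_order all_algebra.
From mathcomp Require Import zify.
Import Order.TTheory GRing.Theory Num.Theory.

Set Implicit Arguments.
Unset Strict Implicit.
Unset Printing Implicit Defensive.

(** * Words and their order *)

(** By [lexical_enc] and [wlt_enc] the statement concerns lexical words of level (length plus one)
    dividing [n]. It is enough to identify the successor of each in D_n: the procedure then follows
    a chain of successors from the empty word, that of (0), up to [1^{n-1}], and such a chain skips
    nothing ([nchain_mem]).

    Successors are found through the periodic words. By [per_max] both z^- and z^+ are maximal among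
    their signed shifts, by [per_le] the intervals from z^- to z^+ are ordered like the z and do not
    overlap, and [top_rotation] extracts an element of D_n from any nonconstant word of period [n].
    So a periodic word slightly above b^+ yields an element of D_n above b, hence at least the
    successor x. [next_flip] feeds b^+ with an end of its period complemented into this machine, and
    finds that x^- itself is such a word when [n] divided by the level of b is odd.

    If that quotient is even, the successor is the first harmonic ([next_h1]); if it is odd and at
    least 3, it is a star product with (2, 1, ..., 1) ([next_oddw]). [blockP] strings these
    together, from f up to level [n]. At level [n] ([next_up]) the successor is a flipped word or a
    shorter word f. In the latter case the flip just after f must be shown lexical ([flip_divisor]),
    for the procedure finds f only as the wedge with that flip. By [flip_next] the last admissible
    flip sits at the end of a run of zeros, where it is an elementary operation on an even cell
    ([op_cell]).

    Every passage lengthens a strictly increasing string over a finite set, and a passage is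
    possible at every element except (n-1). *)

Definition llt (X Y : nat -> nat) : Prop :=
  exists i, (forall j, j < i -> X j = Y j) /\ X i < Y i.

Lemma eq_llt X X' Y Y' : X =1 X' -> Y =1 Y' -> llt X Y -> llt X' Y'.
Proof.
move=> eX eY [i [H1 H2]]; exists i; split; last by rewrite -eX -eY.
by move=> j /H1; rewrite eX eY.
Qed.

Lemma llt_irr X : ~ llt X X.
Proof. by case=> i [_]; rewrite ltnn. Qed.

Lemma llt_trans Y X Z : llt X Y -> llt Y Z -> llt X Z.
Proof.
move=> [i [Hi Li]] [k [Hk Lk]].
case: (ltngtP i k) => ik.
- exists i; split=> [j ji|]; last by rewrite -(Hk _ ik).
  by rewrite Hi // Hk //; exact: ltn_trans ik.
- exists k; split=> [j jk|]; last by rewrite (Hi _ ik).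
  by rewrite Hi ?Hk //; exact: ltn_trans ik.
- subst k; exists i; split=> [j ji|]; first by rewrite Hi ?Hk.
  exact: ltn_trans Li Lk.
Qed.

Lemma llt_total n (X Y : nat -> nat) :
  (forall j, j < n -> X j = Y j) \/ llt X Y \/ llt Y X.
Proof.
elim: n => [|n [IH|IH]]; [by left| |by right].
case: (ltngtP (X n) (Y n)) => h.
- by right; left; exists n.
- by right; right; exists n; split=> // j /IH.
- by left=> j; rewrite ltnS leq_eqVlt => /orP [/eqP->|/IH].
Qed.

Lemma lltNge X Y Z : llt X Y -> ~ llt Z Y -> llt X Z.
Proof.
move=> XY ZY; have [i [Hi Li]] := XY.
case: (llt_total i.+1 Y Z) => [H|[H|//]]; last by exact: llt_trans H.
by exists i; split=> [j ji|]; rewrite -H // ?Hi // ltnS ltnW.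
Qed.

Lemma lleN_lt X Y Z : ~ llt Y X -> llt Y Z -> llt X Z.
Proof.
move=> YX YZ; have [i [Hi Li]] := YZ.
case: (llt_total i.+1 X Y) => [H|[H|//]]; last by exact: llt_trans YZ.
by exists i; split=> [j ji|]; rewrite H // ?Hi // ltnS ltnW.
Qed.

(* The word [w] followed by the end marker, whose value lies strictly between  *)
(* those of the two letters.                                                   *)
Definition code (w : seq bool) (i : nat) : nat :=
  if i < size w then (nth false w i).*2 else 1.

Fixpoint wlt (s t : seq bool) : bool :=
  match s, t with
  | [::], [::] => false
  | [::], b :: _ => b
  | a :: _, [::] => ~~ a
  | a :: s', b :: t' => if a == b then wlt s' t' else b
  end.

Lemma wltP s t : reflect (llt (code s) (code t)) (wlt s t).
Proof.
elim: s t => [|a s IH] [|b t] /=.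
- by constructor=> /llt_irr.
- case: b; constructor; first by exists 0.
  by case=> -[|i] [H //]; have := H 0 isT.
- case: a; constructor; last by exists 0.
  by case=> -[|i] [H //]; have := H 0 isT.
- case: (eqVneq a b) => [<-{b}|nab].
    apply: (iffP (IH t)) => -[i [H1 H2]].
      by exists i.+1; split=> // -[|j] // /H1.
    case: i H1 H2 => [|i] H1 H2; first by rewrite /code /= ltnn in H2.
    by exists i; split=> // j ji; apply: (H1 j.+1).
  case: a b nab => [] [] // _; constructor; last by exists 0.
  by case=> -[|i] [H //]; have := H 0 isT.
Qed.

Lemma wlt_irr s : wlt s s = false.
Proof. by apply/negP=> /wltP /llt_irr. Qed.

Lemma wlt_trans t s u : wlt s t -> wlt t u -> wlt s u.
Proof. by move=> /wltP st /wltP tu; apply/wltP; apply: llt_trans st tu. Qed.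

Lemma wlt_total s t : [\/ s = t, wlt s t | wlt t s].
Proof.
elim: s t => [|a s IH] [|b t] /=; first by constructor 1.
- by case: b; [constructor 2|constructor 3].
- by case: a; [constructor 3|constructor 2].
- rewrite [b == a]eq_sym; case: (eqVneq a b) => [->|nab].
    by case: (IH t) => h; [constructor 1; rewrite h|constructor 2|constructor 3].
  by case: a b nab => [] [] // _; [constructor 3|constructor 2].
Qed.

Lemma wlt_asym s t : wlt s t -> wlt t s -> False.
Proof. by move=> st ts; have := wlt_trans st ts; rewrite wlt_irr. Qed.

Lemma wlt_cat p s t : wlt (p ++ s) (p ++ t) = wlt s t.
Proof. by elim: p => //= a p ->; rewrite eqxx. Qed.

Definition xw (b : bool) (w : seq bool) : seq bool := map (addb b) w.

Lemma size_xw b w : size (xw b w) = size w. Proof. exact: size_map. Qed.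

Lemma nth_xw b w i : i < size w -> nth false (xw b w) i = b (+) nth false w i.
Proof. exact: nth_map. Qed.

Lemma xw_false w : xw false w = w. Proof. by rewrite /xw map_id. Qed.

Lemma xw_cat b s t : xw b (s ++ t) = xw b s ++ xw b t.
Proof. exact: map_cat. Qed.

Lemma xwA b c w : xw b (xw c w) = xw (b (+) c) w.
Proof. by rewrite /xw -map_comp; apply: eq_map => d /=; rewrite addbA. Qed.

Lemma wlt_xw s t : wlt (xw true s) (xw true t) = wlt t s.
Proof.
elim: s t => [|a s IH] [|b t] //=; first by rewrite negbK.
by rewrite IH; case: a b => [] [].
Qed.

(* [i] is the first place where the tail at [k] (complemented if [b]) falls    *)
(* below [t]; the last possible such place is that of the end marker.          *)
Definition falls (t : seq bool) (k : nat) (b : bool) (i : nat) : Prop :=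
  [/\ i <= size t - k,
      forall j, j < i -> b (+) nth false t (k + j) = nth false t j,
      nth false t i
    & i < size t - k -> b (+) nth false t (k + i) = false].

(* Complemented tails occur because the tail of a sequence at an even cell has *)
(* the complement of a suffix of its word as word.                             *)
Definition lexw (t : seq bool) : bool :=
  all (fun k => wlt (xw true (drop k t)) t && wlt (drop k t) t) (iota 1 (size t)).

Lemma lexw_tail t k b :
  lexw t -> 0 < k <= size t -> wlt (xw b (drop k t)) t.
Proof.
move=> /allP H /andP [k0 ks].
have /andP [] : wlt (xw true (drop k t)) t && wlt (drop k t) t.
  by apply: H; rewrite mem_iota; lia.
by case: b; rewrite ?xw_false.
Qed.

Lemma lexwI t :
  (forall k b, 0 < k <= size t -> wlt (xw b (drop k t)) t) -> lexw t.
Proof.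
move=> H; apply/allP=> k; rewrite mem_iota => kt.
have h : 0 < k <= size t by lia.
by rewrite (H k true h) /=; have := H k false h; rewrite xw_false.
Qed.

Lemma code_tail t k b i :
  code (xw b (drop k t)) i =
  if i < size t - k then (b (+) nth false t (k + i)).*2 else 1.
Proof.
rewrite /code size_xw size_drop; case: ifP => // h.
by rewrite nth_xw ?size_drop // nth_drop.
Qed.

Lemma fallsP t k b :
  0 < k <= size t -> wlt (xw b (drop k t)) t <-> exists i, falls t k b i.
Proof.
move=> kt; split.
  move=> /wltP [i [H1 H2]]; exists i.
  have il : i <= size t - k.
    rewrite leqNgt; apply/negP=> h.
    have := H1 _ h; rewrite code_tail ltnn /code.
    case: ifP; last by lia.
    by move=> _; case: (nth _ _ _).
  have agree j : j < i -> b (+) nth false t (k + j) = nth false t j.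
    move=> ji; have := H1 _ ji; rewrite code_tail /code.
    have -> : j < size t - k by lia.
    have -> : j < size t by lia.
    by case: (b (+) _); case: (nth _ _ _).
  move: H2; rewrite code_tail /code; have -> : i < size t by lia.
  move=> H2; split=> //.
    by move: H2; case: ifP; case: (nth false t i) => //; case: (b (+) _).
  by move=> h; move: H2; rewrite h; case: (b (+) _); case: (nth _ _ _).
case=> i [H1 H2 H3 H4]; apply/wltP; exists i; split=> [j ji|].
  rewrite code_tail /code.
  have -> : j < size t - k by lia.
  have -> : j < size t by lia.
  by rewrite H2.
rewrite code_tail /code; have -> : i < size t by lia.
by rewrite H3; case: ifP => // /H4 ->.
Qed.

Lemma lexw_falls t k b : lexw t -> 0 < k <= size t -> exists i, falls t k b i.
Proof. by move=> tl kt; apply/fallsP => //; apply: lexw_tail. Qed.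

Lemma fallsI t : (forall k b, 0 < k <= size t -> exists i, falls t k b i) -> lexw t.
Proof. by move=> H; apply: lexwI => k b kt; apply/fallsP => //; apply: H. Qed.

Lemma lexw_head t : lexw t -> t != [::] -> nth false t 0.
Proof.
case: t => // a t tl _; have /(lexw_falls false tl) [i [h1 _ h2 _]] :
  0 < size (a :: t) <= size (a :: t) by rewrite /= leqnn.
by rewrite subnn leqn0 in h1; rewrite (eqP h1) in h2.
Qed.

(** * Periodic words *)

(* [per z false] is z^- = (z 0)^oo and [per z true] is z^+ = (z 1 ~z 0)^oo.    *)
Definition per (z : seq bool) (c : bool) (i : nat) : bool :=
  nth false (rcons z c) (i %% (size z).+1) (+) (c && odd (i %/ (size z).+1)).

Lemma per_nth z c i : i < size z -> per z c i = nth false z i.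
Proof.
move=> iz; rewrite /per modn_small ?divn_small; try lia.
by rewrite andbF addbF nth_rcons iz.
Qed.

Lemma per_size z c : per z c (size z) = c.
Proof. by rewrite /per modn_small // divn_small // andbF addbF nth_rcons ltnn eqxx. Qed.

Lemma per_shift z c i : per z c ((size z).+1 + i) = c (+) per z c i.
Proof.
rewrite /per modnDl divnDl // divnn /= oddD /=.
by case: c; rewrite /= ?addbF //; case: (nth _ _ _); case: (odd _).
Qed.

Lemma per_shiftM z c q i :
  per z c (q * (size z).+1 + i) = (c && odd q) (+) per z c i.
Proof.
elim: q => [|q IH]; first by rewrite andbF.
by rewrite mulSn -addnA per_shift IH addbA /=; clear IH; case: c; case: (odd q).
Qed.

Definition smax (X : nat -> bool) : Prop :=
  forall k b, ~ llt X (fun i => b (+) X (k + i)).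

Lemma lltb (X Y : nat -> bool) :
  llt X Y <-> exists i, [/\ forall j, j < i -> X j = Y j, X i = false & Y i].
Proof.
split=> [[i [H1 H2]]|[i [H1 H2 H3]]]; exists i.
  split=> [j /H1| |]; [|by move: H2; case: (X i); case: (Y i)..].
  by case: (X j); case: (Y j).
by split=> [j /H1 ->|]; rewrite ?H2 ?H3.
Qed.

Lemma per0 z c : lexw z -> c || (z != [::]) -> per z c 0.
Proof.
case: z => [_|a z zl _]; first by rewrite orbF => ?; rewrite (per_size [::]).
by rewrite per_nth // (lexw_head zl).
Qed.

(** Induction on the place [i] where a signed shift would first exceed the word. Modulo the level,
    the shift starts inside z, and the tail of z there falls below z. This settles the comparison
    unless the fall is at the end of z and the letter [c] prolongs the agreement; what follows is
    then the complement of the word, and the comparison restarts with a smaller [i]. For z empty and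
    [c = false] the word is constantly 0, below its complement. *)
Lemma per_max z c : lexw z -> c || (z != [::]) -> smax (per z c).
Proof.
move=> zl zc; set X := per z c.
have X0 : X 0 by apply: per0.
suff bad i k b : (forall j, j < i -> X j = b (+) X (k + j)) ->
    X i = false -> b (+) X (k + i) -> False.
  by move=> k b /lltb [i [H1 H2 H3]]; apply: bad H1 H2 H3.
have [N] := ubnP i; elim: N i k b => // N IH i k b iN.
have ek j : X (k + j) = (c && odd (k %/ (size z).+1)) (+) X (k %% (size z).+1 + j).
  by rewrite /X {1}(divn_eq k (size z).+1) -addnA per_shiftM.
have kJ := ltn_pmod k (ltn0Sn (size z)).
move: (k %% (size z).+1) (c && odd _) ek kJ => k' d ek kJ H1 H2 H3.
have {}H1 j : j < i -> X j = (b (+) d) (+) X (k' + j) by move=> /H1; rewrite ek addbA.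
have {ek}H3 : (b (+) d) (+) X (k' + i) by rewrite -addbA -ek.
move: (b (+) d) H1 H3 => {d}b H1 H3.
case: k' kJ H1 H3 => [|k'] kJ H1 H3.
  case: b H1 H3 => H1 H3; last by rewrite /= add0n H2 in H3.
  case: i {iN} H1 H2 H3 => [|i] H1 H2 H3; first by rewrite X0 in H2.
  by have := H1 0 isT; rewrite add0n; case: (X 0).
move: k'.+1 (ltn0Sn k') kJ H1 H3 => {}k k0 kJ H1 H3.
have kz : 0 < k <= size z by lia.
have [i0 [F1 F2 F3 F4]] := lexw_falls b zl kz.
have Xz j : j < size z -> X j = nth false z j by apply: per_nth.
have Xi0 : X i0 by rewrite Xz //; lia.
case: (ltngtP i i0) => ii0.
- have i1 : i < size z by lia.
  have i2 : k + i < size z by lia.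
  by move: H3 H2; rewrite (Xz _ i1) (Xz _ i2) (F2 _ ii0) => ->.
- move: F1; rewrite leq_eqVlt => /orP [/eqP ei0|li0]; last first.
    have i1 : k + i0 < size z by lia.
    by have := H1 _ ii0; rewrite Xi0 (Xz _ i1) (F4 li0).
  have := H1 _ ii0; rewrite Xi0; have -> : k + i0 = size z by lia.
  rewrite {1}/X per_size => /esym bc.
  have sh j : b (+) X (k + (i0 + j.+1)) = ~~ X j.
    have -> : k + (i0 + j.+1) = (size z).+1 + j by lia.
    by rewrite /X per_shift addbA bc.
  apply: (IH (i - i0.+1) i0.+1 true); first by lia.
  + move=> j jl; have := H1 (i0 + j.+1); rewrite sh addSnnS => -> /=; last by lia.
    by rewrite negbK.
  + by apply: negbTE; rewrite -sh addnS -addSn subnKC.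
  + by rewrite subnKC // H2.
- by rewrite ii0 Xi0 in H2.
Qed.

Lemma smaxP (X : nat -> bool) k b i :
  smax X -> (forall j, j < i -> X j = b (+) X (k + j)) ->
  X i = false -> b (+) X (k + i) = false.
Proof.
move=> mX H1 H2; apply/negbTE/negP=> H3.
by apply: (mX k b); apply/lltb; exists i.
Qed.

Lemma per_lt z : llt (per z false) (per z true).
Proof.
apply/lltb; exists (size z); rewrite !per_size; split=> // j jz.
by rewrite !per_nth.
Qed.

Lemma wlt_neq0 s t : lexw s -> wlt s t -> t != [::].
Proof. by case: t s => // -[] // [] // s /lexw_head /(_ isT). Qed.

(** If z and z' first differ in letters, so do the periodic words, in the right direction. Otherwise
    one is a prefix of the other, and shifting by its level maps its periodic word to itself or to
    its complement. Up to the supposed first difference the other periodic word inherits this, and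
    its signed shift would exceed it. *)
Lemma per_le z z' :
  lexw z -> lexw z' -> wlt z z' -> ~ llt (per z' false) (per z true).
Proof.
move=> zl zl' zz'.
have z'0 := wlt_neq0 zl zz'.
have mP : smax (per z true) by apply: per_max.
have mQ : smax (per z' false) by apply: per_max.
move/wltP: zz' => [i0 [E1 E2]] /lltb [i [H1 H2 H3]].
have Pz j : j < size z -> per z true j = nth false z j by apply: per_nth.
have Qz j : j < size z' -> per z' false j = nth false z' j by apply: per_nth.
have lti0 : size z <= i0 -> size z' <= i0 -> False.
  by move=> h1 h2; move: E2; rewrite /code !ltnNge h1 h2.
have agree j : j < i0 -> j < size z -> j < size z' ->
    per z true j = per z' false j.
  move=> h1 h2 h3; rewrite Pz // Qz //; have := E1 _ h1; rewrite /code h2 h3.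
  by case: (nth _ _ _); case: (nth _ _ _).
have sz j : j < i0 -> (j < size z) = (j < size z').
  move=> /E1; rewrite /code; do 2!case: ifP => //.
    by case: (nth _ _ _).
  by case: (nth _ z' _).
have i0z : i0 <= size z.
  by rewrite leqNgt; apply/negP=> h; have := sz _ h; rewrite ltnn; lia.
have i0z' : i0 <= size z'.
  by rewrite leqNgt; apply/negP=> h; have := sz _ h; rewrite ltnn; lia.
case: (ltnP i i0) => ii0.
  by rewrite agree ?H2 // in H3; lia.
move: i0z i0z'; rewrite leq_eqVlt [i0 <= size z']leq_eqVlt.
move=> /orP [/eqP e|lz] /orP [/eqP e'|lz'].
- by case: lti0; lia.
- move: E2; rewrite /code e ltnn -e lz'; case Ez: (nth _ _ _) => // _.
  move: ii0; rewrite leq_eqVlt => /orP [/eqP ei|ii0].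
    by rewrite -ei Qz // Ez in H2.
  set J := (size z).+1; have iJ : i = J + (i - J) by rewrite /J; lia.
  have A1 j : j < i - J -> per z' false j = true (+) per z' false (J + j).
    by move=> jl; rewrite !H1 ?per_shift /= ?negbK //; lia.
  have : true (+) per z' false (J + (i - J)) = false.
    apply: smaxP mQ A1 _; rewrite H1; last by lia.
    by move: H3; rewrite {1}iJ per_shift; case: (per z true _).
  by rewrite -iJ H2.
- move: E2; rewrite /code e' ltnn -e' lz; case Ez: (nth _ _ _) => // _.
  move: ii0; rewrite leq_eqVlt => /orP [/eqP ei|ii0].
    by rewrite -ei Pz // Ez in H3.
  set J := (size z').+1; have iJ : i = J + (i - J) by rewrite /J; lia.
  have A1 j : j < i - J -> per z true j = false (+) per z true (J + j).
    by move=> jl; rewrite -!H1 ?per_shift //; lia.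
  have : false (+) per z true (J + (i - J)) = false.
    apply: smaxP mP A1 _; rewrite -H1; last by lia.
    by move: H2; rewrite {1}iJ per_shift.
  by rewrite -iJ H3.
- move: E2; rewrite /code lz lz'.
  case Ez: (nth _ _ _) => //; case Ez': (nth _ _ _) => // _.
  move: ii0; rewrite leq_eqVlt => /orP [/eqP ei|ii0].
    by rewrite -ei Qz // Ez' in H2.
  by have := H1 _ ii0; rewrite Qz // Pz // Ez Ez'.
Qed.

Lemma per_mono z z' : lexw z -> lexw z' -> wlt z z' ->
  llt (per z true) (per z' true).
Proof.
move=> zl zl' zz'; apply: lleN_lt (per_lt z') => h.
by apply: (per_le zl zl' zz').
Qed.

Lemma per_mono0 z z' : lexw z -> lexw z' -> wlt z z' ->
  llt (per z false) (per z' false).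
Proof.
move=> zl zl' zz'; apply: lltNge (per_lt z) _ => h.
by apply: (per_le zl zl' zz').
Qed.

(* The word of h_1(f) = f_o f: since f_o has odd length, the second copy of f  *)
(* is complemented.                                                            *)
Definition h1 (f : seq bool) : seq bool := f ++ true :: xw true f.

Lemma size_h1 f : size (h1 f) = (size f).*2.+1.
Proof. by rewrite size_cat /= size_xw; lia. Qed.

Lemma nth_h1 f i : i < size (h1 f) -> nth false (h1 f) i = per f true i.
Proof.
rewrite size_h1 nth_cat => il; case: ltngtP => [h|h|->].
- by rewrite per_nth.
- have -> : i = (size f).+1 + (i - (size f).+1) by lia.
  rewrite per_shift per_nth; last by lia.
  rewrite -[_ + _ - size f]/(_) addSnnS addKn /= nth_xw //; lia.
- by rewrite per_size subnn.
Qed.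

Lemma per_h1 f : per (h1 f) false =1 per f true.
Proof.
move=> i; rewrite (divn_eq i (size (h1 f)).+1) per_shiftM /=.
have := ltn_pmod i (ltn0Sn (size (h1 f))).
move: (i %% _) => r; move: (i %/ _) => q.
have -> : q * (size (h1 f)).+1 + r = q.*2 * (size f).+1 + r by rewrite size_h1; lia.
rewrite per_shiftM odd_double /= ltnS leq_eqVlt => /orP [/eqP ->|rl].
  rewrite per_size size_h1; have -> : (size f).*2.+1 = (size f).+1 + size f by lia.
  by rewrite per_shift per_size.
by rewrite per_nth // nth_h1.
Qed.

(** An x in between would satisfy x^+ <= h_1(f)^- = f^+ by [per_le], against f^+ < x^+. *)
Lemma h1_gap f x : lexw f -> lexw (h1 f) -> lexw x ->
  wlt f x -> wlt x (h1 f) -> False.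
Proof.
move=> fl hl xl fx xh.
apply: (per_le xl hl xh).
apply: (@eq_llt (per f true) _ (per x true)) => // [i|].
  by rewrite per_h1.
exact: per_mono.
Qed.

(** A word beginning with 10 would lie strictly between the empty word and its first harmonic, the
    word 1. *)
Lemma lexw_second x : lexw x -> 1 < size x -> nth false x 1.
Proof.
move=> xl x1; case e: (nth false x 1) => //; exfalso.
have x0 : nth false x 0 by apply: lexw_head => //; case: (x) x1.
apply: (@h1_gap [::] x) => //; case: x x0 x1 e {xl} => [|[] [|[] ?]] //=.
Qed.

(** * Lexical words cut from maximal periodic words *)

Lemma max_family N (F : nat -> nat -> bool) :
  (forall a b, F a =1 F b \/ llt (F a) (F b) \/ llt (F b) (F a)) ->
  0 < N -> exists2 a, a < N & forall b, b < N -> ~ llt (F a) (F b).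
Proof.
move=> tot; elim: N => // -[|N] IH _.
  by exists 0 => // -[] // _ /llt_irr.
case: (IH isT) => a aN Ha; case: (tot a N.+1) => [e|[h|h]].
- exists a => [|b]; first exact: ltnW.
  rewrite ltnS leq_eqVlt => /orP [/eqP->|/Ha //] /(@eq_llt _ (F N.+1)) H.
  by apply: (@llt_irr (F N.+1)); apply: H => // i; rewrite e.
- exists N.+1 => // b; rewrite ltnS leq_eqVlt => /orP [/eqP->|]; first exact: llt_irr.
  by move=> /Ha H1 H2; apply: H1; apply: llt_trans h H2.
- exists a => [|b]; first exact: ltnW.
  by rewrite ltnS leq_eqVlt => /orP [/eqP-> H|/Ha //]; apply: (@llt_irr (F a)); apply: llt_trans H h.
Qed.

Lemma period_mul (X : nat -> bool) d q i :
  (forall i, X (d + i) = X i) -> X (q * d + i) = X i.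
Proof. by move=> H; elim: q => // q IH; rewrite mulSn -addnA H. Qed.

Lemma llt_total_period n (X Y : nat -> bool) : 0 < n ->
  (forall i, X (n + i) = X i) -> (forall i, Y (n + i) = Y i) ->
  X =1 Y \/ llt X Y \/ llt Y X.
Proof.
move=> n0 pX pY; case: (llt_total n X Y) => [H|]; last by right.
left=> i; rewrite (divn_eq i n) !period_mul //.
by have := H _ (ltn_pmod i n0); case: (X _); case: (Y _).
Qed.

(** A signed tail of the prefix that deviates from M inside the prefix falls there, by maximality.
    One that agrees to the end meets the end marker, which is a fall only against a 1. *)
Lemma mkseq_lexw (M : nat -> bool) l :
  smax M ->
  (forall k s, 0 < k <= l -> (forall j, j < l - k -> M j = s (+) M (k + j)) ->
    M (l - k)) ->
  lexw (mkseq M l).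
Proof.
move=> mM H; apply: fallsI => k s; rewrite size_mkseq => kl.
have bM i : i < l -> nth false (mkseq M l) i = M i by move=> il; rewrite nth_mkseq.
have [/hasP [i il Hi]|/hasPn Hn] :=
  boolP (has (fun i => s (+) M (k + i) != M i) (iota 0 (l - k))).
  have ex1 : exists i, s (+) M (k + i) != M i by exists i.
  have [i1 N1 min1] := ex_minnP ex1.
  have i1l : i1 < l - k.
    by apply: leq_ltn_trans (min1 _ Hi) _; move: il; rewrite mem_iota add0n.
  have ag j : j < i1 -> M j = s (+) M (k + j).
    by move=> ji; apply/esym/eqP/negPn/negP=> /min1; rewrite leqNgt ji.
  have Mi1 : M i1.
    apply/negPn/negP=> h; have := smaxP mM ag (negbTE h).
    by move: N1; rewrite (negbTE h); case: (_ (+) _).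
  exists i1; split; rewrite ?size_mkseq; first by rewrite ltnW.
  - by move=> j ji; rewrite !bM; [rewrite [in RHS](ag _ ji) | lia | lia].
  - by rewrite bM //; lia.
  - by move=> _; rewrite bM; [move: N1; rewrite Mi1; case: (_ (+) _) | lia].
have ag j : j < l - k -> M j = s (+) M (k + j).
  by move=> jl; apply/esym/eqP/negPn/Hn; rewrite mem_iota.
exists (l - k); split; rewrite ?size_mkseq //; last by rewrite ltnn.
- by move=> j jl; rewrite !bM; [rewrite [in RHS](ag _ jl) | lia | lia].
- by rewrite bM; [apply: H kl ag | lia].
Qed.

(** A tail violating the criterion of [mkseq_lexw] agrees with M through the 0 that closes the
    period, after which M starts anew. Comparing M with its shift by [len.+1] in both directions
    then makes [len.+1 < d] a period. *)
Lemma primitive_lexw (M : nat -> bool) d :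
  smax M -> 0 < d -> (forall i, M (d + i) = M i) -> M d.-1 = false ->
  (forall e, 0 < e -> e < d -> ~ forall i, M (e + i) = M i) ->
  lexw (mkseq M d.-1).
Proof.
move=> mM d0 pd Md dmin; apply: (mkseq_lexw mM) => k s kd ag.
set len := d.-1 - k in ag *; have kl : k + len = d.-1 by rewrite /len; lia.
apply/negPn/negP=> /negbTE Ml; have := smaxP mM ag Ml; rewrite kl Md addbF.
case: s ag => // ag _.
have sh j : M (k + (len.+1 + j)) = M j.
  by have -> : k + (len.+1 + j) = d + j by lia.
have e1 : ~ llt (fun i => M (len.+1 + i)) M.
  move=> /lltb [i [H1 H2 H3]]; apply: (mM k false); apply/lltb.
  exists (len.+1 + i); rewrite sh; split=> // j; case: (ltngtP j len) => jl.
  - by move=> _; apply: ag.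
  - move=> ji; have ej : j = len.+1 + (j - len.+1) by lia.
    by rewrite ej sh /= H1 //; lia.
  - by rewrite jl kl Ml Md.
have e2 : ~ llt M (fun i => M (len.+1 + i)) := mM len.+1 false.
apply: (dmin len.+1) => //; first by lia.
move=> i; have pN j : M (len.+1 + (d + j)) = M (len.+1 + j) by rewrite addnCA pd.
by case: (llt_total_period d0 pN pd) => [H|[]//]; apply: H.
Qed.

(** Take the largest signed shift M and its least period [d]. The period ends in 0, since otherwise
    the shift by [d.-1] would start with one more 1 than M. Without that 0 it is the lexical word
    sought. *)
Lemma top_rotation n (X : nat -> bool) u v :
  0 < n -> (forall i, X (n + i) = X i) -> X u -> X v = false ->
  exists b k s, [/\ lexw b /\ b != [::], (size b).+1 %| n, k < n,
    (forall i, per b false i = s (+) X (k + i)) &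
    (forall k' s', ~ llt (per b false) (fun i => s' (+) X (k' + i)))].
Proof.
move=> n0 pX Xu Xv.
(* The parity of [a] is the sign and its half the shift. *)
pose F a i := odd a (+) X (a./2 + i).
have pF a i : F a (n + i) = F a i by rewrite /F addnCA pX.
have tot a b : F a =1 F b \/ llt (F a) (F b) \/ llt (F b) (F a).
  exact: (@llt_total_period n).
have [|a an Ha] := @max_family n.*2 F tot; first by rewrite double_gt0.
have Hk k s : ~ llt (F a) (fun i => s (+) X (k + i)).
  move=> H; apply: (Ha (s + (k %% n).*2)).
    by have := ltn_pmod k n0; case: (s); lia.
  apply: (eq_llt _ _ H) => // i; rewrite /F oddD odd_double addbF half_bit_double.
  rewrite {1}(divn_eq k n) -addnA period_mul //.
  by case: (s).
pose M := F a; have pM i : M (n + i) = M i by exact: pF.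
have mM : smax M.
  move=> k s H; apply: (Hk (a./2 + k) (s (+) odd a)).
  by apply: (eq_llt _ _ H) => // i; rewrite /M /F addnA addbA.
have M0 : M 0.
  apply/negPn/negP=> h; apply: (mM 0 true); apply/lltb; exists 0.
  by rewrite (negbTE h).
have [w Mw] : exists w, M w = false.
  have kn : a./2 < n by lia.
  case E: (odd a).
    exists (n - a./2 + u); rewrite /M /F E addnA subnKC; last exact: ltnW.
    by rewrite pX Xu.
  exists (n - a./2 + v); rewrite /M /F E addnA subnKC; last exact: ltnW.
  by rewrite pX Xv.
pose P d := (0 < d) && all (fun i => M (d + i) == M i) (iota 0 n).
have PE d : 0 < d -> (forall i, M (d + i) = M i) -> P d.
  by move=> d0 H; rewrite /P d0; apply/allP=> i _; rewrite H.
have EP d : P d -> forall i, M (d + i) = M i.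
  case/andP=> _ /allP H i; rewrite (divn_eq i n) addnCA !period_mul //.
  by apply/eqP/H; rewrite mem_iota ltn_pmod.
have [|d Pd dmin] := @ex_minnP P; first by exists n; apply: PE.
have pd := EP _ Pd; have d0 : 0 < d by case/andP: Pd.
have dn : d %| n.
  apply/negPn/negP; rewrite /dvdn -lt0n => r0.
  have : P (n %% d).
    apply: PE => // i; rewrite -(pM i) [in RHS](divn_eq n d) -addnA period_mul //.
  by move=> /dmin; rewrite leqNgt ltn_pmod.
have Md : M d.-1 = false.
  apply/negbTE/negP=> h.
  have ex0 : exists w, ~~ M w by exists w; rewrite Mw.
  have [i Mi imin] := ex_minnP ex0.
  have lti j : j < i -> M j.
    by move=> ji; apply/negPn/negP=> /imin; rewrite leqNgt ji.
  have e j : M (d.-1 + j.+1) = M j by rewrite addnS -addSn prednK // pd.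
  have := @smaxP M d.-1 false i mM; rewrite /= (negbTE Mi).
  case: i Mi imin lti => [|i]; first by rewrite M0.
  move=> Mi imin lti; rewrite e lti // => H; suff : true = false by [].
  apply: H => // j ji; rewrite lti //; case: j ji => [|j] ji; first by rewrite addn0 h.
  by rewrite e lti //; lia.
pose b := mkseq M d.-1.
have sb : (size b).+1 = d by rewrite size_mkseq prednK.
have bM i : i < d.-1 -> nth false b i = M i by move=> id; rewrite nth_mkseq.
have perb : per b false =1 M.
  move=> i; have := per_shiftM b false (i %/ d) (i %% d).
  rewrite sb -divn_eq => ->; rewrite [in RHS](divn_eq i d) period_mul //=.
  have := ltn_pmod i d0; move: (i %% d) => r; rewrite -{1}sb ltnS leq_eqVlt.
  move=> /orP [/eqP->|rb]; first by rewrite per_size size_mkseq Md.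
  by rewrite per_nth // bM //; rewrite size_mkseq in rb.
have d1 : 1 < d.
  rewrite ltnNge; apply/negP=> d1; have e : d.-1 = 0 by lia.
  by rewrite e M0 in Md.
have b0 : b != [::] by apply: contraTneq d1 => eb; rewrite -sb eb.
exists b, a./2, (odd a); split; [split=> // | by rewrite sb | by lia | by [] | ]; last first.
  by move=> k s H; apply: (Hk k s); apply: eq_llt H => // i; rewrite perb.
apply: primitive_lexw => // e e0 ed He.
by have := dmin _ (PE _ e0 He); rewrite leqNgt ed.
Qed.

(** * Consecutive elements of D_n *)

Definition Dw (n : nat) (b : seq bool) : bool := lexw b && ((size b).+1 %| n).

Definition nextw (n : nat) (b x : seq bool) : Prop :=
  [/\ Dw n b, Dw n x, wlt b x &
      forall y, Dw n y -> wlt b y -> wlt y x -> False].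

Lemma per_dvd z c n i : (size z).+1 %| n ->
  per z c (n + i) = (c && odd (n %/ (size z).+1)) (+) per z c i.
Proof. by move=> dn; rewrite -{1}(divnK dn) per_shiftM. Qed.

Lemma per_last z c n : 0 < n -> (size z).+1 %| n -> c ==> odd (n %/ (size z).+1) ->
  per z c n.-1 = c.
Proof.
move=> n0 dn; rewrite -{2}(divnK dn).
have : 0 < n %/ (size z).+1 by rewrite divn_gt0 // dvdn_leq.
case: (n %/ _) => // q _ oq.
rewrite mulSn addSn /= addnC per_shiftM per_size.
by move: oq => /=; case: c; case: (odd q).
Qed.

Lemma const_between (d : nat -> bool) p m :
  (forall j, p < j < m -> d j = d j.-1) -> forall j, p <= j < m -> d j = d p.
Proof.
move=> H; elim=> [|j IH]; first by rewrite leqn0 => /andP [/eqP->].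
case/andP; rewrite leq_eqVlt => /orP [/eqP-> //|pj jm].
by rewrite H ?pj //= IH // -ltnS pj ltnW.
Qed.

Lemma wrapE n k i : k < n -> n - k <= i -> k + i = n + (i - (n - k)).
Proof. lia. Qed.

(** Let [d] mark the places where a = b^+ and [x_] = x^- differ; it must be shown to keep the value
    1 from the first difference [p1] to [n.-1]. For a change [p] of [d] with [a p = 0], the word
    [X p], which is a complemented on p, ..., n-1 and repeated with period [n], exceeds a. Its
    largest signed shift M is b'^- for some b' > b in D_n, so b' >= x, and M dominates every signed
    shift of [x_] and of a. This locates M, and a change of [d] after [p1] then produces a signed
    shift of [x_] above M. *)
Lemma next_flip n b x : 0 < n -> nextw n b x -> odd (n %/ (size b).+1) ->
  exists p, [/\ p < n, per b true p = false &
    forall i, i < n -> per x false i = per b true i (+) (p <= i)].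
Proof.
move=> n0 [/andP [bl bn] /andP [xl xn] bx gap] oq.
have x0 := wlt_neq0 bl bx.
set a := per b true; set x_ := per x false.
have ma : smax a by apply: per_max.
have mx : smax x_ by apply: per_max.
have aN i : a (n + i) = ~~ a i by rewrite /a per_dvd // oq.
have xN i : x_ (n + i) = x_ i by rewrite /x_ per_dvd.
have an1 : a n.-1 by rewrite /a per_last // oq.
have xn1 : x_ n.-1 = false by rewrite /x_ per_last.
have a0 : a 0 by apply: per0.
clear oq bn xn.
have n1n : n.-1 < n by rewrite prednK.
have ax : llt a x_.
  case: (llt_total n a x_) => [H|[//|H]].
    by have := H _ n1n; rewrite an1 xn1.
  by case: (per_le bl xl bx).
have [p1 [agp ap xp]] := proj1 (lltb _ _) ax.
have p1n : p1 < n.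
  rewrite ltnNge; apply/negP=> h.
  by have := agp n.-1 (leq_trans n1n h); rewrite an1 xn1.
pose d i := a i (+) x_ i.
pose d' i := if i is j.+1 then d j else false.
have dlt i : i < p1 -> d i = false by move=> /agp h; rewrite /d h addbb.
have d'le i : i <= p1 -> d' i = false by case: i => // i /dlt.
have dp1 : d p1 by rewrite /d ap xp.
have dn1 : d n.-1 by rewrite /d an1 xn1.
have xd i : x_ i = d i (+) a i by rewrite /d addbAC addbb.
pose X p i := a (i %% n) (+) (p <= i %% n).
have XN p i : X p (n + i) = X p i by rewrite /X modnDl.
have Xlt p i : i < n -> X p i = a i (+) (p <= i) by move=> h; rewrite /X modn_small.
(* The claim about M: it is a shift of [X p] by some k <= p, without complement, and [d] keeps the
   value [d' k] from k to p. *)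
have step p : p < n -> a p = false -> d p != d' p ->
    (forall i, i < p -> d i != d' i -> a i = false) ->
    exists k, [/\ k <= p, (forall i, k <= i < p -> d i = d' k) &
      ~ llt (fun i => X p (k + i)) (fun i => d' k (+) x_ (k + i))].
  move=> pn ap0 chp chl.
  have p1p : p1 <= p.
    rewrite leqNgt; apply/negP=> h.
    by move: chp; rewrite dlt // d'le // ltnW.
  have pn1 : p <= n.-1 by rewrite -ltnS prednK.
  have p0 : 0 < p by case: (p) ap0 => //; rewrite a0.
  have [||b' [k [s [[bl' b0'] bn' kn Mk mM]]]] :=
      @top_rotation n (X p) 0 n.-1 n0 (XN p).
    by rewrite Xlt // a0 leqn0; case: (p) p0.
    by rewrite Xlt // an1 pn1.
  set M := per b' false in Mk mM.
  have aX : llt a (X p).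
    apply/lltb; exists p; rewrite Xlt // ap0 leqnn; split=> // j jp.
    by rewrite Xlt ?(ltn_trans jp) // [p <= j]leqNgt jp addbF.
  have aM : llt a M by apply: lltNge aX (mM 0 false).
  have bb' : wlt b b'.
    case: (wlt_total b b') => // [e|h].
      by case: (@llt_irr a); apply: llt_trans aM _; rewrite /M -e; apply: per_lt.
    case: (@llt_irr a); apply: llt_trans aM _.
    by apply: llt_trans (per_lt _) _; apply: per_mono.
  have Mx : ~ llt M x_.
    case: (wlt_total x b') => [e|h|h]; first by rewrite /M -e; apply: llt_irr.
      move=> h'; apply: (@llt_irr M); apply: llt_trans h' _.
      exact: per_mono0.
    by case: (gap b') => //; rewrite /Dw bl'.
  clear bn'.
  have Mxs k' s' : ~ llt M (fun i => s' (+) x_ (k' + i)).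
    by move=> h; apply: Mx; apply: lltNge h (mx k' s').
  have Mas k' s' : ~ llt M (fun i => s' (+) a (k' + i)).
    by move=> h; apply: Mx; apply: llt_trans (lltNge h (ma k' s')) ax.
  have knE i : n - k <= i -> k + i = n + (i - (n - k)) by apply: wrapE.
  have knl i : i < n - k -> k + i < n by rewrite ltn_subRL.
  (* For p < k the shifted [X p] equals [~~ a (k + i)] until p comes round again, because a changes
     sign after [n]. If M is its complement, M falls below a shift of a at that point; if not, M
     agrees with the complemented shift of a beyond [p1], and that shift is at most a, so M <
     [x_]. *)
  case: (ltnP p k) => pk.
    have Xk i : i < n - k -> X p (k + i) = ~~ a (k + i).
      move=> il; rewrite Xlt; last exact: knl.
      by rewrite (leq_trans (ltnW pk)) ?leq_addr // addbT.
    exfalso; case: s Mk => Mk.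
      apply: (Mas k false); apply/lltb; exists (n - k + p); split.
      - move=> i ip; rewrite Mk /=; case: (ltnP i (n - k)) => il.
          by rewrite Xk // negbK.
        have jp : i - (n - k) < p by rewrite ltn_subLR.
        rewrite knE // aN XN Xlt; last exact: ltn_trans jp pn.
        by rewrite [p <= _]leqNgt jp addbF.
      - by rewrite Mk knE ?leq_addr // addKn XN Xlt // ap0 leqnn.
      - by rewrite knE ?leq_addr // addKn aN ap0.
    have MZ i : i < n - k + p -> M i = true (+) a (k + i).
      move=> ip; rewrite Mk /=; case: (ltnP i (n - k)) => il; first by rewrite Xk.
      have jp : i - (n - k) < p by rewrite ltn_subLR.
      rewrite knE // aN negbK XN Xlt; last exact: ltn_trans jp pn.
      by rewrite [p <= _]leqNgt jp addbF.
    have p1l : p1 < n - k + p by clear - p1p kn; lia.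
    apply: Mx; have agr : (forall i, i <= p1 -> true (+) a (k + i) = a i) -> llt M x_.
      move=> H; apply/lltb; exists p1; split=> //; last by rewrite MZ // H.
      move=> i ip; rewrite MZ ?H ?agp //; first exact: ltnW.
      exact: ltn_trans p1l.
    case: (llt_total p1.+1 a (fun i => true (+) a (k + i))) => [H|[H|]].
    - by apply: agr => i ip; have := H i ip; case: (a i); case: (_ (+) _).
    - by case: (ma k true).
    - move=> /lltb [i0 [H1 H2 H3]]; case: (ltngtP i0 p1) => i0p.
      + apply/lltb; exists i0; split; last by rewrite -agp.
          move=> i ii; rewrite MZ ?H1 ?agp //; first exact: ltn_trans i0p.
          by apply: ltn_trans p1l; apply: ltn_trans i0p.
        by rewrite MZ // (ltn_trans i0p).
      + by apply: agr => i ip; apply: H1; apply: leq_ltn_trans i0p.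
      + by rewrite i0p ap in H3.
  (* A complemented shift from k <= p agrees with the complemented shift of a up to p, where it has
     0 against 1. *)
  case: s Mk => Mk.
    exfalso; apply: (Mas k true); apply/lltb; exists (p - k).
    rewrite Mk subnKC // ap0 Xlt // ap0 leqnn; split=> // i ip.
    have kip : k + i < p by rewrite -ltn_subRL.
    by rewrite Mk Xlt ?(ltn_trans kip) // [p <= _]leqNgt kip addbF.
  have MX : M =1 (fun i => X p (k + i)) by move=> i; rewrite Mk.
  have Mk' : ~ llt (fun i => X p (k + i)) (fun i => d' k (+) x_ (k + i)).
    move=> h; apply: (Mxs k (d' k)); apply: (eq_llt _ _ h) => // i.
    by rewrite MX.
  exists k; split=> // i /andP [ki ip].
  apply/eqP/negPn/negP=> Hi.
  have ex1 : exists j, (k <= j) && (d j != d' k) by exists i; rewrite ki.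
  (* The first place [c] where [d] leaves the value [d' k] is a change, so [a c = 0], and there the
     signed shift of [x_] exceeds M. *)
  have [c /andP [kc Hc] cmin] := ex_minnP ex1.
  have cp : c < p by apply: leq_ltn_trans ip; apply: cmin; rewrite ki.
  have before j : k <= j -> j < c -> d j = d' k.
    move=> kj jc; apply/eqP/negPn/negP=> h.
    by have := cmin j; rewrite kj h leqNgt jc => /(_ isT).
  have ac : a c = false.
    apply: chl => //; move: kc; rewrite leq_eqVlt => /orP [/eqP ekc|].
      by move: Hc; rewrite ekc.
    by case: (c) Hc before => // c' Hc before kc /=; rewrite (before c').
  apply: Mk'; apply/lltb; exists (c - k); rewrite subnKC //; split.
  - move=> j jc; have kjc : k + j < c by rewrite -ltn_subRL.
    rewrite xd before ?leq_addr // addbA addbb Xlt; last by rewrite (ltn_trans kjc) // (ltn_trans cp).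
    by rewrite [p <= _]leqNgt (ltn_trans kjc cp) addbF.
  - by rewrite Xlt ?(ltn_trans cp) // ac [p <= _]leqNgt cp.
  - by rewrite xd ac addbF; move: Hc; case: (d c); case: (d' k).
have stepE p k : k <= p -> (forall i, k <= i < p -> d i = d' k) ->
    d p != d' p -> d p = ~~ d' k.
  rewrite leq_eqVlt => /orP [/eqP ->|kp] H; first by case: (d p); case: (d' p).
  have : d' p = d' k.
    by case: p kp H => // p kp H /=; apply: H; rewrite ltnSn andbT -ltnS.
  by move=> ->; case: (d p); case: (d' k).
have agree p k j : p < n -> k <= p -> (forall i, k <= i < p -> d i = d' k) ->
    d p = ~~ d' k -> k + j < n -> (p <= k + j -> d (k + j) = d p) ->
    X p (k + j) = d' k (+) x_ (k + j).
  move=> pn kp H dp kjn Hj; rewrite Xlt // xd; case: (leqP p (k + j)) => h.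
    by rewrite Hj // dp; case: (d' k); case: (a _).
  by rewrite H ?leq_addr //= addbA addbb addbF.
(* Induction on changes, applying [step] at the preceding change p: from k up to i, [X p] and the
   signed [x_] agree, and [a i = 1] would put [X p] below at i. *)
have Achg i : i < n -> d i != d' i -> a i = false.
  have [N] := ubnP i; elim: N i => // N IH i iN i_n chi.
  case: (ltngtP i p1) => ip1; last by rewrite ip1.
    by move: chi; rewrite dlt // d'le // ltnW.
  have exp : exists q, (q < i) && (d q != d' q).
    by exists p1; rewrite ip1 dp1 d'le.
  have bnd q : (q < i) && (d q != d' q) -> q <= i by case/andP=> /ltnW.
  have [p /andP [pi chp] pmax] := ex_maxnP exp bnd.
  have pn : p < n by apply: ltn_trans i_n.
  have ap0 : a p = false by apply: IH => //; clear - pi iN; lia.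
  have chl q : q < p -> d q != d' q -> a q = false.
    by move=> qp; apply: IH; clear - qp pi iN i_n; lia.
  have [k [kp Hk Hl]] := step p pn ap0 chp chl.
  have dp := stepE p k kp Hk chp.
  have betw : forall j, p <= j < i -> d j = d p.
    apply: const_between => j /andP [pj ji]; apply/eqP/negPn/negP=> h.
    have := pmax j; rewrite ji; case: j pj ji h => // j pj ji h /=.
    by rewrite h => /(_ isT); rewrite leqNgt pj.
  have di : d i = ~~ d p.
    have : d' i = d p.
      by case: (i) pi betw => // j pj betw /=; apply: betw; rewrite ltnSn andbT -ltnS.
    by move: chi => /[swap] ->; case: (d i); case: (d p).
  apply/negbTE/negP=> ai; apply: Hl; apply/lltb; exists (i - k).
  have ki : k <= i by clear - kp pi; lia.
  rewrite subnKC //; split.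
  - move=> j jl; have kji : k + j < i by clear - jl; lia.
    apply: agree => //; first by clear - kji i_n; lia.
    by move=> h; apply: betw; rewrite h.
  - by rewrite Xlt // ai (ltnW pi).
  - by rewrite xd di dp ai; case: (d' k).
have exp : exists q, (q < n) && (d q != d' q).
  by exists p1; rewrite p1n dp1 d'le.
have bnd q : (q < n) && (d q != d' q) -> q <= n by case/andP=> /ltnW.
have [p /andP [pn chp] pmax] := ex_maxnP exp bnd.
have ap0 := Achg p pn chp.
have chl q : q < p -> d q != d' q -> a q = false.
  by move=> qp; apply: Achg; apply: ltn_trans pn.
have [k [kp Hk Hl]] := step p pn ap0 chp chl.
have dp := stepE p k kp Hk chp.
have betw : forall j, p <= j < n -> d j = d p.
  apply: const_between => j /andP [pj ji]; apply/eqP/negPn/negP=> h.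
  have := pmax j; rewrite ji; case: j pj ji h => // j pj ji h /=.
  by rewrite h => /(_ isT); rewrite leqNgt pj.
have d1 : d p by rewrite -(betw n.-1) // n1n andbT -ltnS prednK.
have p1p : p1 <= p by apply: pmax; rewrite p1n dp1 d'le.
move: p1p; rewrite leq_eqVlt => /orP [/eqP e|p1p].
  exists p1; split=> // i i_n; case: (leqP p1 i) => pi.
    by rewrite -/(x_ i) xd betw -e ?pi // dp1 addbC.
  by rewrite -/(x_ i) -agp // addbF.
(* If the last change p comes after [p1], the agreement runs past [n] and round to [p1], where a has
   0 and [x_] has 1. *)
exfalso; apply: Hl; have d'k : d' k = false by move: dp; rewrite d1; case: (d' k).
apply/lltb; exists (n - k + p1).
have e1 : k + (n - k + p1) = n + p1 by clear - kp pn; lia.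
rewrite e1 XN xN d'k xp Xlt // ap [p <= p1]leqNgt p1p; split=> // j jl.
case: (ltnP (k + j) n) => kjn.
  rewrite -d'k; apply: agree => // h.
  by apply: betw; rewrite h.
have -> : k + j = n + (k + j - n) by clear - kjn; lia.
have jl' : k + j - n < p1 by clear - jl kp pn kjn; lia.
rewrite XN xN Xlt; last by clear - jl' p1n; lia.
by rewrite agp // [p <= _]leqNgt (ltn_trans jl' p1p) addbF.
Qed.

(** A tail reaching the end of the common prefix is continued, with its sign, by a 1: by [P l] if
    complemented, by [Q l] if not. Maximality of P or of Q then requires a 1 at place [l - k], as
    [mkseq_lexw] asks. *)
Lemma fork_lexw (P Q : nat -> bool) l :
  smax P -> smax Q -> (forall j, j < l -> P j = Q j) -> P l = false -> Q l ->
  lexw (mkseq P l).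
Proof.
move=> mP mQ PQ Pl Ql; apply: (mkseq_lexw mP) => k s kl ag.
have kE : k + (l - k) = l by lia.
case: s ag => ag.
  apply/negPn/negP=> /negbTE h.
  by have := smaxP mP ag h; rewrite kE Pl.
rewrite PQ; last by lia.
apply/negPn/negP=> /negbTE h.
have agQ j : j < l - k -> Q j = false (+) Q (k + j).
  move=> jl; have jl1 : j < l by lia.
  have jl2 : k + j < l by lia.
  by rewrite -(PQ _ jl1) -(PQ _ jl2); apply: ag.
by have := smaxP mQ agQ h; rewrite kE Ql.
Qed.

(** Otherwise the common prefix before the first difference is lexical by [fork_lexw] and lies
    strictly between z and z'. *)
Lemma gap_agree n z z' :
  lexw z -> lexw z' -> wlt z z' ->
  (forall y, lexw y -> size y < n -> wlt z y -> wlt y z' -> False) ->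
  forall i, i < n -> per z true i = per z' false i.
Proof.
move=> zl zl' zz' gap i i_n; apply/eqP/negPn/negP=> ne.
set P := per z true in ne; set Q := per z' false in ne.
have z'0 := wlt_neq0 zl zz'.
have mP : smax P by apply: per_max.
have mQ : smax Q by apply: per_max.
have : llt P Q.
  case: (llt_total i.+1 P Q) => [/(_ i (ltnSn i))|[//|h]].
    by move: ne; case: (P i); case: (Q i).
  by case: (per_le zl zl' zz').
move=> /lltb [l [ag Pl Ql]].
have il : l <= i by rewrite leqNgt; apply/negP=> /ag e; rewrite e eqxx in ne.
set g := mkseq P l; have gl : lexw g by apply: (fork_lexw mP mQ).
have sg : size g = l by rewrite size_mkseq.
have pg c j : j < l -> per g c j = P j by move=> jl; rewrite per_nth ?sg // nth_mkseq.
have pgl c : per g c l = c by rewrite -{1}sg per_size.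
apply: (gap g) => //; first by rewrite sg; apply: leq_ltn_trans i_n.
  case: (wlt_total z g) => // [e|h].
    by move: Pl; rewrite /P e pgl.
  case: (@llt_irr P); apply: llt_trans (per_mono gl zl h).
  by apply/lltb; exists l; rewrite pgl; split=> // j jl; rewrite pg.
case: (wlt_total g z') => // [e|h].
  by move: Ql; rewrite /Q -e pgl.
case: (@llt_irr Q); apply: llt_trans (per_mono0 zl' gl h) _.
by apply/lltb; exists l; rewrite pgl; split=> // j jl; rewrite pg ?ag.
Qed.

Fixpoint words (n : nat) : seq (seq bool) :=
  if n is k.+1 then
    [::] :: [seq true :: w | w <- words k] ++ [seq false :: w | w <- words k]
  else [:: [::]].

Lemma mem_words n w : size w <= n -> w \in words n.
Proof.
elim: n w => [|n IH] [|b w] //= /IH wn; rewrite inE /= mem_cat.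
by case: b; rewrite map_f // orbT.
Qed.

Lemma wlt_has_max (s : seq (seq bool)) y0 : y0 \in s ->
  exists2 y, y \in s & forall y', y' \in s -> ~~ wlt y y'.
Proof.
case: s => // x s _ {y0}; elim: s x => [|y s IH] x.
  by exists x; rewrite ?mem_head // => y; rewrite inE => /eqP ->; rewrite wlt_irr.
case: (IH y) => z zs Hz; case: (boolP (wlt z x)) => zx.
  exists x; rewrite ?mem_head // => w; rewrite inE => /orP [/eqP ->|/Hz wz].
    by rewrite wlt_irr.
  by apply: contra wz => xw; apply: wlt_trans zx xw.
exists z; first by rewrite inE zs orbT.
by move=> w; rewrite inE => /orP [/eqP ->|/Hz].
Qed.

Lemma wlt_has_min (s : seq (seq bool)) y0 : y0 \in s ->
  exists2 y, y \in s & forall y', y' \in s -> ~~ wlt y' y.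
Proof.
case: s => // x s _ {y0}; elim: s x => [|y s IH] x.
  by exists x; rewrite ?mem_head // => y; rewrite inE => /eqP ->; rewrite wlt_irr.
case: (IH y) => z zs Hz; case: (boolP (wlt x z)) => zx.
  exists x; rewrite ?mem_head // => w; rewrite inE => /orP [/eqP ->|/Hz wz].
    by rewrite wlt_irr.
  by apply: contra wz => xw; apply: wlt_trans xw zx.
exists z; first by rewrite inE zs orbT.
by move=> w; rewrite inE => /orP [/eqP ->|/Hz].
Qed.

Lemma Dw_size n b : 0 < n -> Dw n b -> size b < n.
Proof. by move=> n0 /andP [_ /dvdn_leq] H; apply: H. Qed.

Lemma next_exists n b y : 0 < n -> Dw n b -> Dw n y -> wlt b y ->
  exists x, nextw n b x.
Proof.
move=> n0 bn yn by_.
have : y \in [seq x <- words n | Dw n x && wlt b x].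
  by rewrite mem_filter yn by_ mem_words // ltnW // Dw_size.
move=> /wlt_has_min [x]; rewrite mem_filter => /andP [/andP [xn bx] _] H.
exists x; split=> // z zn bz zx; apply: (negP (H z _) zx).
by rewrite mem_filter zn bz mem_words // ltnW // Dw_size.
Qed.

(** Whether the last two of the first [n] letters differ; this is the invariant that decides
    [flip_divisor]. *)
Definition wlast (n : nat) (X : nat -> bool) : bool := X n.-1 (+) X n.-2.

(** Within one copy of z a common sign does not affect the difference of two letters. If the pair is
    the letter [c] and the start of the next copy, the sign change after [c] compensates for [c].
    The remaining position, with [c] last, occurs only if the level divides [n]. *)
Lemma wlast_sign z n : 1 < n -> ~~ ((size z).+1 %| n) ->
  wlast n (per z true) = wlast n (per z false).
Proof.
move=> n1 Jn; rewrite /wlast.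
have r0 : 0 < n %% (size z).+1 by rewrite lt0n.
have rJ := ltn_pmod n (ltn0Sn (size z)).
have nE := divn_eq n (size z).+1.
move: (n %/ _) (n %% _) r0 rJ nE => q [|[|r]] // _ rJ nE.
  case: q nE => [|q] nE; first by rewrite nE in n1.
  have -> : n.-2 = q * (size z).+1 + size z by rewrite nE; lia.
  have -> : n.-1 = q.+1 * (size z).+1 + 0 by rewrite nE; lia.
  have z0 : 0 < size z by lia.
  by rewrite !per_shiftM !per_size !per_nth //=; case: (odd q); case: (nth _ _ _).
have -> : n.-2 = q * (size z).+1 + r by rewrite nE; lia.
have -> : n.-1 = q * (size z).+1 + r.+1 by rewrite nE; lia.
by rewrite !per_shiftM !per_nth //; lia.
Qed.

Lemma count_lt (T : eqType) (p q : pred T) (s : seq T) x :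
  subpred p q -> x \in s -> q x -> ~~ p x -> count p s < count q s.
Proof.
move=> pq xs qx px; rewrite -(cat_take_drop (index x s) s) !count_cat.
rewrite -addnS leq_add ?sub_count //.
rewrite (drop_nth x) ?index_mem //= nth_index // qx (negbTE px) add0n add1n.
by rewrite ltnS sub_count.
Qed.

(* An intermediate value argument: [wlast] takes the same value at z^+ and at  *)
(* z^- unless the level of z divides [n], and z^+ agrees up to [n] with the    *)
(* z^- of the next word of level at most [n].                                  *)
Lemma wlast_between n b x z : 1 < n -> nextw n b x -> size b = n.-1 ->
  lexw z -> (size z).+1 < n -> wlt b z -> wlt z x ->
  wlast n (per z false) = wlast n (per b true).
Proof.
move=> n1 [bD _ _ gap] sb zl zn bz zx.
have n0 : 0 < n by apply: ltnW.
have bl : lexw b by case/andP: bD.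
have [N] := ubnP (count (fun y => wlt y z) (words n)).
elim: N z zl zn bz zx => // N IH z zl zn bz zx cN.
pose s := [seq y <- words n | [&& lexw y, size y < n, wlt y z & ~~ wlt y b]].
have sP y : (y \in s) = [&& lexw y, size y < n, wlt y z & ~~ wlt y b].
  rewrite mem_filter; case: (boolP [&& _, _, _ & _]) => //= /and4P [_ h _ _].
  by rewrite mem_words // ltnW.
have bs : b \in s by rewrite sP bl bz wlt_irr sb prednK ?leqnn.
have [y ys ymax] := wlt_has_max bs.
move: ys; rewrite sP => /and4P [yl yn yz yb].
have ag : forall i, i < n -> per y true i = per z false i.
  apply: gap_agree => // w wl wn yw wz.
  have /ymax : w \in s.
    rewrite sP wl wn wz; apply/negP=> wb; case/negP: yb.
    exact: wlt_trans yw wb.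
  by rewrite yw.
have <- : wlast n (per y true) = wlast n (per z false).
  by rewrite /wlast !ag //; lia.
case: (wlt_total y b) => [-> //|h|by_]; first by rewrite h in yb.
have yx : wlt y x by apply: wlt_trans yz zx.
have yD : ~~ ((size y).+1 %| n).
  by apply/negP=> h; apply: (gap y) => //; rewrite /Dw yl.
have ysn : (size y).+1 < n.
  move: yn; rewrite leq_eqVlt => /orP [/eqP e|//].
  by rewrite e dvdnn in yD.
rewrite wlast_sign //; apply: IH => //.
rewrite -ltnS; apply: leq_trans cN; rewrite ltnS.
apply: (@count_lt _ _ _ _ y) => //.
- by move=> w wy; apply: wlt_trans wy yz.
- by rewrite mem_words // ltnW.
- by rewrite wlt_irr.
Qed.

(** * Comparing concatenations; flips *)

Lemma wlt_cases p q : wlt p q -> size p <= size q ->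
  (exists u x y, p = u ++ false :: x /\ q = u ++ true :: y) \/
  (exists y, q = p ++ true :: y).
Proof.
elim: p q => [|a p IH] [|b q] //=; first by case: b => // _ _; right; exists q.
rewrite ltnS; case: (eqVneq a b) => [<-|nab] pq sz.
  case: (IH _ pq sz) => [[u [x [y [-> ->]]]]|[y ->]].
    by left; exists (a :: u), x, y.
  by right; exists y.
left; exists [::], p, q; split; last by rewrite pq.
by move: nab; rewrite pq; case: (a).
Qed.

Lemma wlt_fork u x y : wlt (u ++ false :: x) (u ++ true :: y).
Proof. by rewrite wlt_cat. Qed.

Lemma wlt_ext u y : wlt u (u ++ true :: y).
Proof. by rewrite -{1}(cats0 u) wlt_cat. Qed.

Lemma wlt_ext0 u y : wlt (u ++ false :: y) u.
Proof. by rewrite -{2}(cats0 u) wlt_cat. Qed.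

Lemma wlt_catl p q x y : wlt p q -> size p <= size q ->
  (forall r, q = p ++ r -> wlt x (r ++ y)) -> wlt (p ++ x) (q ++ y).
Proof.
move=> pq sz H; case: (wlt_cases pq sz) => [[u [x' [y' [ep eq]]]]|[r e]].
  by rewrite ep eq -!catA wlt_fork.
by move: (H _ e); rewrite e -catA wlt_cat.
Qed.

(** Complementing [~h < a] gives [~a < h] if the two differ in a letter. Otherwise a continues [~h]
    with a 1, so [~a] continues h with a 0, below the appended 1. *)
Lemma compl_lt_suffix a u h x y : lexw a -> a = u ++ h -> u != [::] ->
  wlt (xw true a ++ x) (h ++ true :: y).
Proof.
move=> al e u0; have us : 0 < size u by rewrite lt0n size_eq0.
have : wlt (xw true (drop (size u) a)) a.
  by apply: lexw_tail; rewrite // us e size_cat leq_addr.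
rewrite e drop_size_cat // -e => H.
have sz : size (xw true h) <= size a by rewrite size_xw e size_cat leq_addl.
case: (wlt_cases H sz) => [[v [x' [y' [eh ea]]]]|[y' ea]].
  have -> : h = xw true v ++ true :: xw true x'.
    by rewrite -[h]xw_false -[false]/(true (+) true) -xwA eh xw_cat.
  by rewrite ea xw_cat /= -!catA wlt_fork.
rewrite ea xw_cat xwA xw_false -catA /=; exact: wlt_fork.
Qed.

Ltac nlia :=
  repeat match goal with
  | H : is_true (wlt _ _) |- _ => clear H
  | H : is_true (lexw _) |- _ => clear H
  | H : is_true (nth _ _ _) |- _ => clear H
  | H : is_true (per _ _ _) |- _ => clear H
  | H : per _ _ _ = _ |- _ => clear H
  | H : nth _ _ _ = _ |- _ => clear H
  | H : forall _, _ |- _ => clear H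
  | H : nextw _ _ _ |- _ => clear H
  | H : is_true (Dw _ _) |- _ => clear H
  | H : is_true (dvdn _ _) |- _ => clear H
  | H : smax _ |- _ => clear H
  | H : is_true (_ != _) |- _ => clear H
  end; lia.

(* Both elementary operations become this flip, applied to the last letter of  *)
(* an even cell.                                                               *)
Definition flipw (t : seq bool) (q : nat) : seq bool :=
  take q t ++ true :: xw true (drop q.+1 t).

Lemma flip_split t q : q < size t -> nth false t q = false ->
  t = take q t ++ false :: drop q.+1 t.
Proof. by move=> qt <-; rewrite -drop_nth // cat_take_drop. Qed.

Lemma size_flipw t q : q < size t -> size (flipw t q) = size t.
Proof. by move=> qt; rewrite size_cat /= size_xw size_takel ?size_drop; lia. Qed.

Lemma nth_flipw t q i : q < size t -> i < size t -> nth false t q = false ->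
  nth false (flipw t q) i = nth false t i (+) (q <= i).
Proof.
move=> qt it tq; rewrite nth_cat size_takel; last exact: ltnW.
case: (ltngtP i q) => iq.
- by rewrite nth_take // addbF.
- have -> : i - q = (i - q.+1).+1 by lia.
  rewrite /= nth_xw ?size_drop; last by lia.
  by rewrite nth_drop subnKC // addbT.
- by rewrite iq subnn /= tq.
Qed.

Lemma wlt_flip t q : q < size t -> nth false t q = false -> wlt t (flipw t q).
Proof. by move=> qt tq; rewrite {1}(flip_split qt tq) wlt_fork. Qed.

Lemma drop_catl (T : Type) k (u v : seq T) : k <= size u ->
  drop k (u ++ v) = drop k u ++ v.
Proof.
move=> ku; rewrite drop_cat; case: ltnP => // uk.
have -> : k = size u by lia.
by rewrite subnn drop0 drop_size.
Qed.

Lemma wlt_lower e g x y x' y' : size e < size g ->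
  wlt (e ++ true :: x) (g ++ y) -> wlt (e ++ false :: x') (g ++ y').
Proof.
elim: e g => [|b e IH] [|c g] //=; first by case: c.
by rewrite ltnS => sz; case: eqP => // _; apply: IH.
Qed.

(** Tails starting after q are complemented tails of t. Complemented tails starting earlier lie
    below those of t. For the other tails, start from the flip at q and lower one letter
    ([wlt_lower]). The consequence is that the last admissible flip ends a run of zeros. *)
Lemma flip_next t q : lexw t -> q.+1 < size t ->
  nth false t q = false -> nth false t q.+1 = false ->
  lexw (flipw t q) -> lexw (flipw t q.+1).
Proof.
move=> tl qt tq tq1; have qt' := ltnW qt.
pose G := take q t; pose r := drop q.+2 t.
have sG : size G = q by rewrite size_takel // ltnW.
have et : t = G ++ false :: false :: r.
  by rewrite {1}(flip_split qt' tq) (drop_nth false) // tq1.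
have -> : flipw t q = G ++ true :: true :: xw true r.
  by rewrite /flipw (drop_nth false) // tq1.
have eV : flipw t q.+1 = G ++ false :: true :: xw true r.
  by rewrite /flipw (take_nth false) // tq cat_rcons.
move=> Ul; set V := flipw t q.+1 in eV *.
have tV : wlt t V by apply: wlt_flip.
have sV : size V = size t by apply: size_flipw.
apply: lexwI => k s /andP [k0]; rewrite sV => kt.
case: (leqP k q) => kq; last first.
  apply: wlt_trans tV; have -> : drop k V = xw true (drop k t).
    rewrite eV et !drop_cat sG ltnNge (ltnW kq) /=.
    have : 0 < k - q by lia.
    by case: (k - q) => // -[|j] _; rewrite /= ?drop0 // /xw map_drop.
  by rewrite xwA; apply: lexw_tail => //; rewrite k0.
have kG : k <= size G by rewrite sG.
have -> : drop k V = drop k G ++ false :: true :: xw true r.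
  by rewrite eV drop_catl.
case: s.
  apply: wlt_trans tV; apply: wlt_trans (lexw_tail true tl (_ : 0 < k <= size t)); last by rewrite k0.
  by rewrite et drop_catl // !xw_cat wlt_cat.
rewrite xw_false eV.
have : wlt (xw false (drop k (G ++ true :: true :: xw true r)))
           (G ++ true :: true :: xw true r).
  by apply: lexw_tail => //; rewrite k0 size_cat sG; lia.
rewrite xw_false drop_catl //.
by apply: wlt_lower; rewrite size_drop; lia.
Qed.

Lemma tail_flip t q k : q < k -> drop k (flipw t q) = xw true (drop k t).
Proof.
move=> qk; rewrite /flipw; case: (ltnP q (size t)) => qt; last first.
  rewrite [drop k t]drop_oversize; last by lia.
  rewrite drop_oversize // size_cat /= size_xw take_oversize // size_drop; lia.
rewrite drop_cat size_takel; last exact: ltnW.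
rewrite ltnNge (ltnW qk) /=; have -> : k - q = (k - q.+1).+1 by lia.
by rewrite /= /xw -map_drop drop_drop subnK.
Qed.

(** If p came before the last copy of f, then t would end in the complement of f, and f > t would
    contradict that t is lexical. *)
Lemma next_divisor n t f : 1 < n -> size t = n.-1 -> nextw n t f ->
  size f < n.-1 ->
  exists p d, [/\ n = d.+2 * (size f).+1, p < n.-1,
    d.+1 * (size f).+1 <= p
    & forall i, i < n -> per f false i = per t true i (+) (p <= i)].
Proof.
move=> n1 st nxt sfn; have [/andP [tl _] /andP [fl fn] tf gap] := nxt.
have n0 := ltnW n1.
have [p [pn ap xE]] : exists p, [/\ p < n, per t true p = false &
    forall i, i < n -> per f false i = per t true i (+) (p <= i)].
  by apply: next_flip => //; rewrite st prednK // divnn n0.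
have aE i : i < n.-1 -> per t true i = nth false t i by move=> h; rewrite per_nth ?st.
have an1 : per t true n.-1 by rewrite -st per_size.
have pn1 : p < n.-1.
  by rewrite ltn_neqAle -ltnS prednK // pn andbT; apply: contraTneq an1 => <-; rewrite ap.
pose m := (size f).+1.
have pf i : i < size f -> forall q, per f false (q * m + i) = nth false f i.
  by move=> h q; rewrite per_shiftM per_nth.
have [d dn] : exists d, n = d.+2 * m.
  move/dvdnP: fn => [[|[|d]] e]; last by exists d.
    by rewrite e in n0.
  by move: sfn; rewrite e /m; nlia.
clear fn.
exists p, d; split=> //.
rewrite leqNgt; apply/negP=> pl.
  have knt : d.+1 * m <= size t by rewrite st dn; nlia.
  have k0 : 0 < d.+1 * m by rewrite /m; nlia.
  have : wlt (xw true (drop (d.+1 * m) t)) t by apply: lexw_tail => //; rewrite k0.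
  suff -> : xw true (drop (d.+1 * m) t) = f by apply: wlt_asym.
  have sd : size (drop (d.+1 * m) t) = size f by rewrite size_drop st dn /m; nlia.
  apply: (@eq_from_nth _ false); rewrite size_xw sd // => i isf.
  rewrite nth_xw ?sd // nth_drop -(pf i isf d.+1) xE; last by rewrite dn /m; nlia.
  rewrite aE; last by rewrite dn /m; nlia.
  by rewrite (leq_trans (ltnW pl)) ?leq_addr // addbT.
Qed.

(** Only a tail [e 1 ~s] with [f = e 1 h] is in doubt, and it fails only if [h 1 ~s < ~s]. When [n]
    is at least three times the level of f, s begins with f and [compl_lt_suffix] excludes this.
    When it is twice the level, [z = f 0 ~h] would be a lexical word of level below [n] strictly
    between t and f, which contradicts [wlast_between]. *)
Lemma flip_divisor n t f s : 1 < n -> t = f ++ false :: s -> size t = n.-1 ->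
  nextw n t f -> lexw (flipw t (size f)).
Proof.
move=> n1 et st nxt; have [/andP [tl _] /andP [fl fn] tf gap] := nxt.
have n0 := ltnW n1.
have f0 := wlt_neq0 tl tf; have sf0 : 0 < size f by rewrite lt0n size_eq0.
have sts : n.-1 = (size f).+1 + size s by rewrite -st et size_cat /= addnS.
have [|p [d [dn pn1 pnm xE]]] := next_divisor n1 st nxt; first by rewrite sts; nlia.
have aE i : i < n.-1 -> per t true i = nth false t i by move=> h; rewrite per_nth ?st.
have an1 : per t true n.-1 by rewrite -st per_size.
set m := (size f).+1 in dn pnm sts.
have pf i : i < size f -> forall q, per f false (q * m + i) = nth false f i.
  by move=> h q; rewrite per_shiftM per_nth.
clear fn.
set U := flipw t (size f).
have EU : U = f ++ true :: xw true s.
  have ds : drop (size f).+1 t = s by rewrite et -cat_rcons drop_size_cat // size_rcons.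
  by rewrite /U /flipw ds et take_size_cat.
have sft : size f < size t by rewrite et size_cat /=; nlia.
have tU : wlt t U.
  by apply: wlt_flip => //; rewrite et nth_cat ltnn subnn.
have sU : size U = size t by apply: size_flipw.
apply: lexwI => k sg; rewrite sU => /andP [k0 kt].
case: (ltnP (size f) k) => kf.
  by apply: wlt_trans tU; rewrite tail_flip // xwA; apply: lexw_tail => //; rewrite k0.
have dU : drop k U = drop k f ++ true :: xw true s by rewrite EU drop_catl.
have dt : drop k t = drop k f ++ false :: s by rewrite et drop_catl.
case: sg.
  apply: wlt_trans tU; apply: wlt_trans (lexw_tail true tl (_ : 0 < k <= size t)); last by rewrite k0.
  by rewrite dU dt !xw_cat; apply: wlt_fork.
rewrite xw_false dU EU.
have fk := lexw_tail false fl; have {fk}: wlt (drop k f) f.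
  by have := fk k; rewrite xw_false k0; apply.
move=> ef; apply: wlt_catl => //; first by rewrite size_drop leq_subr.
set e := drop k f in ef dU dt * => r fE.
case: r fE => [|b h] fE.
  by have := congr1 size fE; rewrite cats0 size_drop; nlia.
have bt : b by move: ef; rewrite {1}fE -{1}(cats0 e) wlt_cat.
rewrite {b}bt in fE * => /=.
have se : size f = size e + (size h).+1 by rewrite {1}fE size_cat.
case: (wlt_total (xw true s) (h ++ true :: xw true s)) => // [e0|hs].
  by have := congr1 size e0; rewrite size_cat /= size_xw; nlia.
exfalso; case: d dn pnm => [|d] dn pnm; last first.
  have st' : s = f ++ drop (size f) s.
    have sfs : size f <= size s by rewrite -(leq_add2l m) -sts dn /m; nlia.
    rewrite -{1}(cat_take_drop (size f) s); congr (_ ++ _).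
    apply: (@eq_from_nth _ false); rewrite size_takel // => i isf.
    rewrite nth_take // -(pf i isf 1) mul1n xE; last by rewrite dn /m; nlia.
    rewrite [p <= _]leqNgt; have -> /= : m + i < p.
      by apply: leq_trans pnm; rewrite /m; nlia.
    rewrite addbF aE; last by rewrite dn /m; nlia.
    by rewrite et -cat_rcons nth_cat size_rcons ltnNge leq_addr /= addKn.
  apply: (wlt_asym hs); rewrite st' xw_cat.
  apply: (@compl_lt_suffix _ (rcons e true)) => //; first by rewrite cat_rcons.
  by rewrite -size_eq0 size_rcons.
rewrite mul1n in pnm.
have ss : size s = size f by move: sts; rewrite dn /m; nlia.
have nthf i : i < size f -> per t true (m + i) = nth false f i (+) (p <= m + i).
  move=> isf; have := pf i isf 1; rewrite mul1n xE; last by rewrite dn /m; nlia.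
  by move=> <-; rewrite -addbA addbb addbF.
have nths i : i < size f -> nth false s i = per t true (m + i).
  move=> isf; rewrite aE; last by rewrite dn /m; nlia.
  by rewrite et -cat_rcons nth_cat size_rcons ltnNge leq_addr /= addKn.
have s0 : nth false s 0.
  rewrite nths // nthf // addn0 (lexw_head fl f0).
  rewrite addTb; apply/negP=> pm; have {pm}pE : p = m by apply/eqP; rewrite eqn_leq pm.
  have : wlt (xw true (drop m t)) t by apply: lexw_tail; rewrite // st dn /m; nlia.
  suff -> : xw true (drop m t) = f by apply: wlt_asym.
  have -> : drop m t = s by rewrite et -cat_rcons drop_size_cat // size_rcons.
  apply: (@eq_from_nth _ false); rewrite size_xw ss // => i isf.
  by rewrite nth_xw ?ss // nths // nthf // pE leq_addr addbT /= negbK.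
(* For e empty, [f = 1 h]; by [lexw_second] h is empty or starts with 1, while [~s] starts with 0,
   against [hs]. *)
have e0 : 0 < size e.
  rewrite lt0n; apply/eqP=> /size0nil e_nil; rewrite e_nil in fE.
  move: hs s0; case: (s) => [|[] s'] //=.
  case: h fE {se} => [|[] h] //= fE _ _.
  have : nth false f 1 by apply: lexw_second => //; rewrite fE.
  by rewrite fE.
have sz : wlt s (xw true h).
  rewrite -wlt_xw xwA xw_false; apply: wlt_trans hs; exact: wlt_ext.
pose z := f ++ false :: xw true h.
have tz : wlt t z by rewrite et wlt_cat.
have zf : wlt z f by apply: wlt_ext0.
have szz : size z = size f + (size h).+1 by rewrite size_cat /= size_xw.
have zl : lexw z.
  apply: lexwI => j sg /andP [j0]; rewrite szz => jz.
  case: (ltnP (size f) j) => jf.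
    have -> : drop j z = xw true (drop (size e + (j - size f)) f).
      have -> : drop (size e + (j - size f)) f = drop (j - size f) (true :: h).
        by rewrite {2}fE drop_cat ltnNge leq_addr /= addKn.
      rewrite /z drop_cat ltnNge (ltnW jf) /=.
      have : 0 < j - size f by nlia.
      by case: (j - size f) => // i _; rewrite /= /xw map_drop.
    rewrite xwA; set q := size e + _.
    have qf : 0 < q <= size f by rewrite /q; nlia.
    rewrite -[X in wlt X _]cats0; apply: wlt_catl (lexw_tail _ fl qf) _ _.
      by rewrite size_xw size_drop leq_subr.
    move=> r e1; have : 0 < size r.
      by have := congr1 size e1; rewrite size_cat size_xw size_drop; nlia.
    case: r e1 => // b r e1 _; have := lexw_tail (sg (+) true) fl qf.
    by rewrite {2}e1 -{1}[xw _ _]cats0 wlt_cat.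
  have jf' : 0 < j <= size f by rewrite j0.
  rewrite /z drop_catl // xw_cat; apply: wlt_catl (lexw_tail _ fl jf') _ _.
    by rewrite size_xw size_drop leq_subr.
  case=> [|b r] e1.
    by have := congr1 size e1; rewrite cats0 size_xw size_drop; nlia.
  have bt : b.
    have := lexw_tail sg fl jf'.
    by rewrite {2}e1 -{1}[xw _ _]cats0 wlt_cat.
  rewrite {b}bt in e1 *; case: sg e1 => // e1.
  rewrite /= -/(xw true (xw true h)) xwA xw_false.
  (* The chain is [h < h 1 ~s < ~s < r 0 s < r 0 ~h]; its third inequality is the complemented tail
     of t at [j]. *)
  apply: (@wlt_trans (h ++ true :: xw true s)); first exact: wlt_ext.
  apply: (wlt_trans hs).
  apply: (@wlt_trans (r ++ false :: s)); last by rewrite wlt_cat.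
  have jt : 0 < j <= size t by rewrite st dn /m; nlia.
  have et' : t = xw true (drop j f) ++ true :: (r ++ false :: s).
    by rewrite {1}et {1}e1 -catA.
  by have := lexw_tail true tl jt; rewrite {2}et' {1}et drop_catl // xw_cat wlt_cat.
have zn : (size z).+1 < n by rewrite szz dn /m; nlia.
(* With l the last letter of f, which is also that of e, the first [n] letters of z^- end in l 1 and
   those of t^+ in ~l 1. *)
have := wlast_between n1 nxt st zl zn tz zf.
rewrite /wlast an1.
have -> : n.-2 = (size z).+1 + (size e).-1 by rewrite szz dn /m; nlia.
have n1E : n.-1 = (size z).+1 + size e by rewrite szz dn /m; nlia.
rewrite {1}n1E !per_shift; have ef' : (size e).-1 < size e by rewrite prednK.
have sef : size e < size f by rewrite se; nlia.
have sez : size e < size z by rewrite szz; nlia.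
have pz j : j < size z -> per z false j = nth false z j by apply: per_nth.
rewrite !pz //; last exact: ltn_trans sez.
rewrite /z !nth_cat sef (ltn_trans ef' sef).
rewrite {1}fE nth_cat ltnn subnn /=.
rewrite -/z; set i := (size z).+1 + _.
have iE : i = m + (size f).-1 by rewrite /i szz /m; nlia.
have sfp : (size f).-1 < size f by rewrite prednK.
have pi : p <= i.
  have : i.+1 = n.-1 by rewrite n1E /i; nlia.
  by move=> iS; rewrite -ltnS iS.
rewrite iE nthf // -iE pi addbT /=.
suff -> : nth false f (size e).-1 = nth false f (size f).-1 by case: (nth _ _ _).
have e2 : nth false e (size e).-1 = nth false f (size f).-1.
  by rewrite /e nth_drop size_drop; congr nth; move: e0; rewrite /e size_drop; nlia.
by rewrite -e2 {1}fE nth_cat ef'.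
Qed.

Lemma take_flipw t p q : p <= q -> q < size t -> take p (flipw t q) = take p t.
Proof.
move=> pq qt; rewrite /flipw takel_cat; first by rewrite take_takel.
by rewrite size_takel // ltnW.
Qed.

(** If x has level [n], it is the flip at the p of [next_flip]; the prefix before p is lexical by
    [fork_lexw] and would lie between t and x if its level divided [n]. If x is shorter, t continues
    it with a 0, and [flip_divisor] applies. A lexical flip further right would be an element of D_n
    between t and x. *)
Lemma next_up n t x : 1 < n -> size t = n.-1 -> nextw n t x ->
  exists q, [/\ q < size t, nth false t q = false,
    lexw (flipw t q) /\ lexw (take q t),
    x = (if q.+1 %| n then take q t else flipw t q)
    & forall q', q < q' < size t -> nth false t q' = false -> ~~ lexw (flipw t q')].
Proof.
move=> n1 st nxt; have [/andP [tl _] /andP [xl xn] tx gap] := nxt.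
have n0 := ltnW n1; have x0 := wlt_neq0 tl tx.
have flipD q : q < size t -> lexw (flipw t q) -> Dw n (flipw t q).
  by move=> qt ql; rewrite /Dw ql size_flipw // st prednK // dvdnn.
have sx : size x <= n.-1 by rewrite -ltnS prednK // Dw_size // /Dw xl.
have gapq q' : q' < size t -> nth false t q' = false -> wlt (flipw t q') x ->
    ~~ lexw (flipw t q').
  move=> q't tq' fx; apply/negP=> /(flipD _ q't) fD.
  by apply: gap fx => //; apply: wlt_flip.
move: sx; rewrite leq_eqVlt => /orP [/eqP sx|sx].
  have [p [pn ap xE]] : exists p, [/\ p < n, per t true p = false &
      forall i, i < n -> per x false i = per t true i (+) (p <= i)].
    by apply: next_flip => //; rewrite st prednK // divnn n0.
  have pt : p < size t.
    rewrite ltn_neqAle -ltnS st prednK // pn andbT -st.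
    by apply: contraFneq ap => ->; rewrite per_size.
  have tp : nth false t p = false by move: ap; rewrite per_nth.
  have ex : x = flipw t p.
    apply: (@eq_from_nth _ false); first by rewrite size_flipw // sx st.
    rewrite sx -st => i it; rewrite nth_flipw // -(per_nth true it).
    rewrite -xE ?per_nth //; first by rewrite sx -st.
    by apply: leq_trans it _; rewrite st leq_pred.
  have gl : lexw (take p t).
    have -> : take p t = mkseq (per t true) p.
      apply: (@eq_from_nth _ false); first by rewrite size_takel ?size_mkseq // ltnW.
      rewrite size_takel; last exact: ltnW.
      by move=> i ip; rewrite nth_take // nth_mkseq // per_nth // (ltn_trans ip).
    apply: (@fork_lexw _ (per x false)); rewrite ?ap //; try by apply: per_max.
      by move=> j jp; rewrite xE ?(ltn_trans jp) // [p <= j]leqNgt jp addbF.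
    by rewrite xE // ap leqnn.
  exists p; split=> //; first by rewrite -ex.
    case: ifP => // pd; exfalso; apply: (gap (take p t)).
    - by rewrite /Dw gl size_takel // ltnW.
    - by rewrite {1}(flip_split pt tp); apply: wlt_ext0.
    - by rewrite ex; apply: wlt_ext.
  move=> q' /andP [pq q't] tq'; apply: gapq => //.
  rewrite ex [flipw t p]/flipw -(cat_take_drop p (flipw t q')).
  have fp : p < size (flipw t q') by rewrite size_flipw.
  rewrite (drop_nth false fp) nth_flipw // tp [q' <= p]leqNgt pq /=.
  suff -> : take p (flipw t q') = take p t by apply: wlt_fork.
  by rewrite take_flipw // ltnW.
have [p [d [dn pn1 pnm xE]]] := next_divisor n1 st nxt sx.
have sxp : size x < p by apply: leq_trans pnm; rewrite mulSn addSn ltnS leq_addr.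
have xt : size x < size t by rewrite st.
have tE i : i <= size x -> nth false t i = per x false i.
  move=> ix; have it : i < size t by apply: leq_ltn_trans xt.
  rewrite xE; last by apply: leq_trans it _; rewrite st leq_pred.
  by rewrite per_nth // [p <= i]leqNgt (leq_ltn_trans ix sxp) addbF.
have tx_ : take (size x) t = x.
  apply: (@eq_from_nth _ false); rewrite size_takel // ?(ltnW xt) // => i ix.
  by rewrite nth_take // tE ?per_nth // ltnW.
have tq : nth false t (size x) = false by rewrite tE // per_size.
have et := flip_split xt tq; rewrite tx_ in et.
exists (size x); split=> //; rewrite ?tx_ ?xn //.
  by split=> //; apply: flip_divisor et st nxt.
move=> q' /andP [pq q't] tq'; apply: gapq => //.
rewrite -(cat_take_drop (size x) (flipw t q')).
have fp : size x < size (flipw t q') by rewrite size_flipw.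
rewrite (drop_nth false fp) nth_flipw // tq [q' <= _]leqNgt pq /=.
suff -> : take (size x) (flipw t q') = x by apply: wlt_ext0.
by rewrite take_flipw ?tx_ // ltnW.
Qed.

Lemma next_up_cell t q : lexw t ->
  q.+1 < size t -> nth false t q = false -> lexw (flipw t q) ->
  (forall q', q < q' < size t -> nth false t q' = false -> ~~ lexw (flipw t q')) ->
  nth false t q.+1.
Proof.
move=> tl qt tq ql H; apply/negPn/negP=> /negbTE tq1.
have /negP : ~~ lexw (flipw t q.+1) by apply: H; rewrite ?ltnSn.
by apply; apply: flip_next.
Qed.

(** * Star product and harmonics of words *)

(** What follows the leading a in the word of a star product ([enc_star]). *)
Definition blocks (a b : seq bool) : seq bool := flatten [seq c :: xw c a | c <- b].
Definition wstar (a b : seq bool) : seq bool := a ++ blocks a b.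

Lemma blocks_cons a c b : blocks a (c :: b) = c :: xw c a ++ blocks a b.
Proof. by []. Qed.

Lemma blocks_cat a b b' : blocks a (b ++ b') = blocks a b ++ blocks a b'.
Proof. by rewrite /blocks map_cat flatten_cat. Qed.

Lemma size_blocks a b : size (blocks a b) = size b * (size a).+1.
Proof. by elim: b => //= c b IH; rewrite size_cat size_xw IH. Qed.

Lemma size_wstar a b : (size (wstar a b)).+1 = (size b).+1 * (size a).+1.
Proof. by rewrite size_cat size_blocks; lia. Qed.

Lemma xw_blocks s a b : xw s (blocks a b) = blocks a (xw s b).
Proof. by elim: b => //= c b IH; rewrite xw_cat xwA IH. Qed.

Lemma blocks_nil b : blocks [::] b = b.
Proof. by elim: b => // c b IH; rewrite blocks_cons IH. Qed.

Lemma wlt_blocks a p q : wlt p q -> wlt (blocks a p) (blocks a q).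
Proof.
elim: p q => [|c p IH] [|c' q] //=; rewrite -/(blocks a p) -/(blocks a q).
by case: eqP => [<-|//]; rewrite wlt_cat; apply: IH.
Qed.

Lemma drop_blocks a b s k : k <= size (xw s a ++ blocks a b) ->
  exists r s' b', [/\ drop k (xw s a ++ blocks a b) = xw s' (drop r a) ++ blocks a b',
    r <= size a &
    [/\ s' = s, b' = b & r = k] \/ exists i, drop i b = s' :: b'].
Proof.
elim: b s k => [|c b IH] s k kl.
  have ka : k <= size a by move: kl; rewrite cats0 size_xw.
  exists k, s, [::]; split=> //; last by left.
  by rewrite drop_catl ?size_xw // /xw map_drop.
case: (leqP k (size a)) => ka.
  exists k, s, (c :: b); split=> //; last by left.
  by rewrite drop_catl ?size_xw // /xw map_drop.
have kE : k = size (xw s a) + (k - (size a).+1).+1 by rewrite size_xw; lia.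
have [|r [s' [b' [dE ra H]]]] := IH c (k - (size a).+1).
  by move: kl; rewrite blocks_cons !size_cat /= size_cat !size_xw; lia.
exists r, s', b'; split=> //.
  by rewrite kE drop_cat ltnNge leq_addr /= addKn.
by right; case: H => [[-> -> _]|[i Hi]]; [exists 0; rewrite drop0|exists i.+1].
Qed.

(** A tail starting with a whole copy of a is decided by its sign or, through [wlt_blocks], by b
    being lexical. A tail starting inside a copy is decided by a being lexical, except when it
    agrees with a to the end of that copy. A following 1 then introduces a complemented copy of a,
    and [compl_lt_suffix] applies. *)
Lemma wstar_lexw a b : lexw a -> lexw b -> b != [::] -> lexw (wstar a b).
Proof.
case: (eqVneq a [::]) => [-> _ bl _|a0 al bl b0]; first by rewrite /wstar blocks_nil.
have bh := lexw_head bl b0.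
apply: lexwI => k s /andP [k0 kl].
have kl' : k <= size (xw false a ++ blocks a b) by rewrite xw_false.
have [r [s' [b' [dE ra H]]]] := drop_blocks kl'.
rewrite xw_false in dE; rewrite -/(wstar a b) in dE.
rewrite dE xw_cat xwA xw_blocks; set c := s (+) s'.
case: (posnP r) => r0.
  case: H => [[_ _ rk]|[i Hi]]; first by rewrite -rk r0 in k0.
  rewrite r0 drop0; have ib : i < size b.
    by rewrite ltnNge; apply/negP=> h; rewrite drop_oversize in Hi.
  have {}Hi : drop i.+1 b = b' by rewrite -addn1 addnC -drop_drop Hi /= drop0.
  have ah := lexw_head al a0.
  case: c; first by case: (a) a0 ah => // -[].
  rewrite xw_false wlt_cat; apply: wlt_blocks; rewrite -Hi.
  by apply: lexw_tail.
have ra' : 0 < r <= size a by rewrite r0.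
apply: wlt_catl (lexw_tail c al ra') _ _; first by rewrite size_xw size_drop leq_subr.
move=> h ah; case: h ah => [|d h] ah.
  by have := congr1 size ah; rewrite cats0 size_xw size_drop; lia.
have dt : d by have := lexw_tail c al ra'; rewrite {2}ah -{1}[xw _ _]cats0 wlt_cat.
rewrite {d}dt in ah *; case: (xw s b') => [|[] v] //.
rewrite blocks_cons /=.
case: b bl b0 bh kl kl' dE H => // -[] // b _ _ _ _ _ _ _.
rewrite blocks_cons; apply: (@compl_lt_suffix _ (rcons (xw c (drop r a)) true)) => //.
  by rewrite cat_rcons.
by rewrite -size_eq0 size_rcons.
Qed.

Lemma h1_wstar f : h1 f = wstar f [:: true].
Proof. by rewrite /wstar blocks_cons cats0. Qed.

Lemma lexw_h1 f : lexw f -> lexw (h1 f).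
Proof. by move=> fl; rewrite h1_wstar wstar_lexw. Qed.

Lemma wlt_h1 f : wlt f (h1 f).
Proof. exact: wlt_ext. Qed.

Lemma next_h1 n f : lexw f -> ((size f).+1).*2 %| n -> nextw n f (h1 f).
Proof.
move=> fl fn; have hl := lexw_h1 fl.
split; rewrite /Dw ?fl ?hl ?size_h1 //=.
- by apply: dvdn_trans fn; rewrite -mul2n dvdn_mull.
- exact: wlt_h1.
- by move=> y /andP [yl _] fy yh; apply: (h1_gap fl hl yl fy yh).
Qed.

Definition alt (k : nat) : seq bool := flatten (nseq k [:: false; true]).
(* The word of (2, 1^{2 k}). *)
Definition oddw (k : nat) : seq bool := [:: true, true & alt k].

Lemma size_alt k : size (alt k) = k.*2.
Proof. by elim: k => //= k ->. Qed.

Lemma nth_alt k i : i < k.*2 -> nth false (alt k) i = odd i.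
Proof. by elim: k i => // k IH [|[|i]] //= ik; rewrite IH ?negbK. Qed.

Lemma nth_oddw k i : i < k.*2.+2 -> nth false (oddw k) i = (i == 0) || odd i.
Proof. by case: i => [|[|i]] //= ik; rewrite nth_alt ?negbK. Qed.

Lemma oddw_lexw k : lexw (oddw k).
Proof.
apply: fallsI => j s; have sz : size (oddw k) = k.*2.+2 by rewrite /= size_alt.
rewrite sz => /andP [j0 jk].
move: jk; rewrite leq_eqVlt => /orP [/eqP ->|jk].
  by exists 0; split; rewrite ?sz ?subnn.
case e: (s (+) nth false (oddw k) j); last first.
  by exists 0; split; rewrite ?addn0.
exists 1; split=> //; rewrite ?sz; first by lia.
  by case=> //; rewrite addn0 e.
by move=> j1; move: e; rewrite !nth_oddw ?addn1; lia.
Qed.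

Lemma nth_blocks_alt f k i : i < size (xw true f ++ blocks f (alt k)) ->
  nth false (xw true f ++ blocks f (alt k)) i = ~~ per f true i.
Proof.
elim: k i => [|k IH] i.
  by rewrite cats0 size_xw => il; rewrite nth_xw // per_nth.
have -> : xw true f ++ blocks f (alt k.+1) =
    xw true (h1 f) ++ true :: (xw true f ++ blocks f (alt k)).
  by rewrite /= !blocks_cons xw_cat /= -/(xw _ (xw _ _)) xwA !xw_false -catA.
rewrite size_cat /= => il.
rewrite nth_cat size_xw; case: ltngtP => ih; last first.
- rewrite ih subnn /= size_h1; have -> : (size f).*2.+1 = (size f).+1 + size f by lia.
  by rewrite per_shift per_size.
- have -> : i = size (h1 f) + (i - (size (h1 f)).+1).+1 by lia.
  rewrite addKn /= IH; last by rewrite size_xw in il; lia.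
  rewrite size_h1; set j := i - _.
  have -> : (size f).*2.+1 + j.+1 = (size f).+1 + ((size f).+1 + j) by lia.
  by rewrite !per_shift; case: (per _ _ _).
- by rewrite nth_xw // nth_h1.
Qed.

Lemma nth_wstar_oddw f k i : i < size (wstar f (oddw k)) ->
  nth false (wstar f (oddw k)) i = per f true i (+) ((size f).*2.+1 <= i).
Proof.
have -> : wstar f (oddw k) = h1 f ++ true :: (xw true f ++ blocks f (alt k)).
  by rewrite /wstar /oddw !blocks_cons /h1 -catA.
rewrite size_cat /= => il.
rewrite nth_cat -size_h1; case: ltngtP => ih; last first.
- rewrite ih subnn size_h1 /=; have -> : (size f).*2.+1 = (size f).+1 + size f by lia.
  by rewrite per_shift per_size.
- have -> : i = size (h1 f) + (i - (size (h1 f)).+1).+1 by lia.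
  rewrite addKn /= nth_blocks_alt; last by lia.
  rewrite size_h1; set j := i - _.
  have -> : (size f).*2.+1 + j.+1 = (size f).+1 + ((size f).+1 + j) by lia.
  by rewrite !per_shift addbT; case: (per _ _ _).
- by rewrite nth_h1 // addbF.
Qed.

(** The candidate y complements f^+ from q on, q being the last place of the first period of f^+;
    the successor x does so from some p. If p < q, then x would be above y. If p > q, the shift of
    x^- by that period would exceed x^- at p. If p = q, y^- is at most x^-, which excludes x < y. *)
Lemma next_oddw n f k : lexw f -> n = k.*2.+3 * (size f).+1 ->
  nextw n f (wstar f (oddw k)).
Proof.
move=> fl nE; have n0 : 0 < n by rewrite nE.
set y := wstar f _; have yl : lexw y by apply: wstar_lexw => //; apply: oddw_lexw.
have sy : (size y).+1 = n by rewrite size_wstar /= size_alt nE.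
have fD : Dw n f by rewrite /Dw fl nE dvdn_mull.
have yD : Dw n y by rewrite /Dw yl sy dvdnn.
have fy : wlt f y by rewrite /y /wstar blocks_cons; apply: wlt_ext.
have [x nxt] := next_exists n0 fD yD fy.
suff -> : y = x by [].
have [_ /andP [xl xn] fx gap] := nxt.
have [p [pn ap xE]] : exists p, [/\ p < n, per f true p = false &
    forall i, i < n -> per x false i = per f true i (+) (p <= i)].
  by apply: next_flip => //; rewrite nE mulnK //= odd_double.
have x0 := wlt_neq0 fl fx.
pose q := (size f).*2.+1.
have yE i : i < n.-1 -> per y false i = per f true i (+) (q <= i).
  by rewrite -sy /= => il; rewrite per_nth // nth_wstar_oddw.
have qn : q < n.-1 by rewrite nE /q; nlia.
have fq : per f true q = false.
  have -> : q = (size f).+1 + size f by rewrite /q; nlia.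
  by rewrite per_shift per_size.
have mono u v : lexw u -> lexw v -> wlt u v -> llt (per v false) (per u false) -> False.
  move=> ul vl uv h; apply: (@llt_irr (per u false)).
  by apply: llt_trans h; apply: per_mono0.
case: (wlt_total y x) => // [yx|xy]; first by case: (gap y).
exfalso; case: (ltngtP p q) => pq.
- apply: (mono _ _ xl yl xy); apply/lltb; exists p.
  rewrite xE // yE ?(ltn_trans pq) // ap leqnn [q <= p]leqNgt pq; split=> // j jp.
  have jn : j < n.-1 by apply: ltn_trans qn; apply: ltn_trans pq.
  rewrite yE // xE; last by apply: leq_trans jn (leq_pred _).
  by rewrite [q <= j]leqNgt (ltn_trans jp pq) [p <= j]leqNgt jp.
- have q2 : q.+1 <= p by [].
  have mx : smax (per x false) by apply: per_max.
  have apq : per f true (p - q.+1) = false.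
    have pE : p = (size f).+1 + ((size f).+1 + (p - q.+1)) by rewrite /q in q2 *; nlia.
    by move: ap; rewrite {1}pE !per_shift; case: (per _ _ _).
  have A1 j : j < p - q.+1 -> per x false j = false (+) per x false (q.+1 + j).
    move=> jl; have jp : q.+1 + j < p by nlia.
    rewrite !xE; [|nlia..].
    rewrite [p <= j]leqNgt [p <= _ + j]leqNgt jp /=.
    have -> : j < p by nlia.
    have -> : q.+1 + j = (size f).+1 + ((size f).+1 + j) by rewrite /q; nlia.
    by rewrite !per_shift; case: (per _ _ _).
  have : false (+) per x false (q.+1 + (p - q.+1)) = false.
    apply: (smaxP mx A1); rewrite xE; last by nlia.
    by rewrite apq [p <= _]leqNgt; have -> : p - q.+1 < p by nlia.
  by rewrite subnKC // xE // ap leqnn.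
- case/lltb: (per_mono0 xl yl xy) => i [_ Xi Yi].
  have perN w : (size w).+1 %| n -> per w false i = per w false (i %% n).
    by move=> wn; rewrite {1}(divn_eq i n) period_mul // => j; rewrite per_dvd.
  move: Xi Yi; rewrite !perN ?sy ?dvdnn //; have := ltn_pmod i n0.
  move: (i %% n) => {perN}i; rewrite -{1}(prednK n0) ltnS leq_eqVlt.
  case/orP=> [/eqP ->|il]; first by rewrite -sy per_size.
  rewrite yE // xE ?pq; last by apply: leq_trans il (leq_pred _).
  by case: (_ (+) _).
Qed.

(** * Sequences and their words *)

Lemma seq_ltP a b :
  reflect (exists i, (forall j, j < i -> Al a j = Al b j) /\ (Al a i < Al b i)%R)
          (seq_lt a b).
Proof.
apply: (iffP hasP) => [[i _ /andP [H1 /allP H2]]|[i [H1 H2]]]; exists i => //.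
- by split=> // j ji; apply/eqP/H2; rewrite mem_iota.
- rewrite mem_iota /= add0n leq_max; move: H2; rewrite /Al.
  case: ltnP => // h1; case: ltnP => // h2.
  by rewrite !nth_default // ltxx.
- by rewrite H2; apply/allP=> j; rewrite mem_iota => /andP [_ ji]; apply/eqP/H1.
Qed.

Lemma AlS x a i : Al (x :: a) i.+1 = (- Al a i)%R.
Proof. by rewrite /Al /= exprS mulN1r mulNr. Qed.

Lemma Al0 x a : Al (x :: a) 0 = x%:Z%R.
Proof. by rewrite /Al expr0 mul1r. Qed.

Lemma seq_lt_cons x y a b :
  seq_lt (x :: a) (y :: b) = if x == y then seq_lt b a else x < y.
Proof.
case: (eqVneq x y) => [<-|nxy].
  apply/seq_ltP/seq_ltP => -[i [H1 H2]].
    case: i H1 H2 => [|i] H1; first by rewrite !Al0 ltxx.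
    rewrite !AlS ltrN2 => H2; exists i; split=> // j ji.
    by have := H1 j.+1 ji; rewrite !AlS => /oppr_inj.
  exists i.+1; rewrite !AlS ltrN2; split=> // -[|j] ji; rewrite ?Al0 // !AlS.
  by rewrite H1.
apply/seq_ltP/idP => [[[|i] [H1 H2]]|xy].
- by move: H2; rewrite !Al0.
- by have := H1 0 isT; rewrite !Al0 => -[] e; rewrite e eqxx in nxy.
- by exists 0; split=> //; rewrite !Al0.
Qed.

Lemma seq_lt_nil y b : 0 < y -> seq_lt [::] (y :: b).
Proof.
by move=> y0; apply/seq_ltP; exists 0; rewrite Al0 /Al /= mulr0 ltz_nat.
Qed.

Lemma seq_lt_consN x a : 0 < x -> seq_lt (x :: a) [::] = false.
Proof.
move=> x0; apply/negP=> /seq_ltP [[|i] [H1 H2]].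
  by move: H2; rewrite Al0 /Al /= mulr0 ltz_nat.
by have := H1 0 isT; rewrite Al0 /Al /= mulr0 => -[] e; rewrite e in x0.
Qed.

(** Lets (0), whose word is empty, be compared like the empty sequence. *)
Lemma Al_zero i : Al [:: 0] i = Al [::] i.
Proof. by rewrite /Al; case: i => [|[|i]]. Qed.

Lemma seq_lt_zerol b : seq_lt [:: 0] b = seq_lt [::] b.
Proof.
apply/seq_ltP/seq_ltP => -[i [H1 H2]]; exists i; rewrite ?Al_zero in H2 *;
  split=> // j /H1; by rewrite Al_zero.
Qed.

Lemma seq_lt_zeror a : seq_lt a [:: 0] = seq_lt a [::].
Proof.
apply/seq_ltP/seq_ltP => -[i [H1 H2]]; exists i; rewrite ?Al_zero in H2 *;
  split=> // j /H1; by rewrite Al_zero.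
Qed.

Fixpoint runs (b : bool) (a : seq nat) : seq bool :=
  if a is x :: a' then nseq x b ++ runs (~~ b) a' else [::].

Definition enc : seq nat -> seq bool := runs true.

Notation pos := (all (leq 1)).

Lemma runs_cat b p r : runs b (p ++ r) = runs b p ++ runs (b (+) odd (size p)) r.
Proof.
elim: p b => [|x p IH] b /=; first by rewrite addbF.
by rewrite IH catA addNb addbN.
Qed.

Lemma runs_xw s b a : runs (s (+) b) a = xw s (runs b a).
Proof.
elim: a b => //= x a IH b; rewrite xw_cat -IH addbN; congr (_ ++ _).
by rewrite /xw map_nseq.
Qed.

Lemma runs_false a : runs false a = xw true (enc a).
Proof. by rewrite -(runs_xw true true). Qed.

Lemma size_runs b a : size (runs b a) = sumn a.
Proof. by elim: a b => //= x a IH b; rewrite size_cat size_nseq IH. Qed.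

Lemma wlt_runs x b t : 0 < x -> pos b -> wlt (runs false b) (nseq x true ++ t).
Proof. by case: x => // x _; case: b => //= -[]. Qed.

(** After equal first cells both orders are reversed, one by the alternating sign and the other by
    complementing. After unequal ones the shorter run meets a 0 or the end marker, both below 1. *)
Lemma wlt_enc a b : pos a -> pos b -> wlt (enc a) (enc b) = seq_lt a b.
Proof.
have [N] := ubnP (size a + size b); elim: N a b => // N IH a b.
case: a b => [|x a] [|y b] sz pa pb; first by apply/esym/negbTE/seq_ltP => -[i []]; rewrite ltxx.
- case/andP: pb => y0 _; rewrite seq_lt_nil //.
  by case: y y0 sz.
- case/andP: pa => x0 _; rewrite seq_lt_consN //.
  by case: x x0 sz.
- case/andP: pa => x0 pa; case/andP: pb => y0 pb; rewrite seq_lt_cons.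
  have lt u v c d : u < v -> pos c -> wlt (enc (u :: c)) (enc (v :: d)).
    move=> uv pc; rewrite /enc /= -(subnKC (ltnW uv)) nseqD -catA wlt_cat.
    by apply: wlt_runs; rewrite // subn_gt0.
  case: (ltngtP x y) => xy.
  + by rewrite lt.
  + by apply/negbTE/negP=> h; apply: (wlt_asym h); apply: lt.
  + rewrite xy /enc /= wlt_cat !runs_false wlt_xw IH //.
    by rewrite addnC; rewrite /= in sz; lia.
Qed.

Lemma alpha_seqP a : alpha_seq a -> a = [:: 0] \/ a != [::] /\ pos a.
Proof. by case/orP=> [/eqP ->|/andP [h1 h2]]; [left|right]. Qed.

Lemma alpha_seq_pos a : pos a -> a != [::] -> alpha_seq a.
Proof. by move=> h1 h2; rewrite /alpha_seq h1 h2 orbT. Qed.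

Lemma wlt_alpha a b : alpha_seq a -> alpha_seq b ->
  wlt (enc a) (enc b) = seq_lt a b.
Proof.
move=> /alpha_seqP [->|[_ pa]] /alpha_seqP [->|[_ pb]];
  rewrite ?seq_lt_zerol ?seq_lt_zeror -wlt_enc //.
Qed.

Lemma runs_inj b a a' : pos a -> pos a' -> runs b a = runs b a' -> a = a'.
Proof.
elim: a a' b => [|x a IH] [|y a'] b //=.
- by move=> _ /andP []; case: y.
- by move=> /andP []; case: x.
move=> /andP [x0 pa] /andP [y0 pa'].
have hd c d : pos c -> nth (~~ d) (runs (~~ d) c) 0 = ~~ d.
  by case: c => // -[|z] c.
move=> e; have exy : x = y.
  wlog xy : x y a a' pa pa' x0 y0 e {IH} / x < y.
    move=> H; case: (ltngtP x y) => // h; first exact: (H x y a a').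
    by apply/esym; apply: (H y x a' a).
  move: e; rewrite -(subnKC (ltnW xy)) nseqD -catA => /(congr1 (drop x)).
  rewrite !drop_size_cat ?size_nseq // => e; have := hd a b pa; rewrite e.
  have : 0 < y - x by rewrite subn_gt0.
  by case: (y - x) => // z _ /=; case: (b).
congr (_ :: _) => //; apply: (IH _ (~~ b)) => //.
by move: e => /(congr1 (drop x)); rewrite {2}exy !drop_size_cat ?size_nseq.
Qed.

Lemma enc_inj a a' : alpha_seq a -> alpha_seq a' -> enc a = enc a' -> a = a'.
Proof.
have nz c : c != [::] -> pos c -> enc c <> [::] by case: c => // -[].
move=> /alpha_seqP [->|[a0 pa]] /alpha_seqP [->|[a0' pa']] // e.
- by case: (nz a').
- by case: (nz a).
- exact: runs_inj e.
Qed.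

Lemma enc_drop a k : k <= size a ->
  enc (drop k a) = xw (odd k) (drop (sumn (take k a)) (enc a)).
Proof.
move=> ka; rewrite -{3}(cat_take_drop k a) {2}/enc runs_cat.
rewrite drop_size_cat ?size_runs // size_takel // -runs_xw.
by congr (runs _ _); case: (odd k).
Qed.

Lemma drop_runs b a p : p < sumn a ->
  exists k v, [/\ k < size a, 0 < v <= nth 0 a k,
    drop p (runs b a) = nseq v (b (+) odd k) ++ runs (~~ (b (+) odd k)) (drop k.+1 a)
    & k = 0 -> v = nth 0 a k -> p = 0].
Proof.
elim: a b p => //= x a IH b p pl.
case: (ltnP p x) => px.
  exists 0, (x - p); split=> //=; last by lia.
    by lia.
  rewrite drop_catl ?size_nseq ?(ltnW px) // drop0 addbF.
  by congr (_ ++ _); rewrite -{1}(subnKC (ltnW px)) nseqD drop_size_cat ?size_nseq.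
have [|k [v [ka vk dE _]]] := IH (~~ b) (p - x); first by lia.
exists k.+1, v; split=> //=.
by rewrite drop_cat size_nseq ltnNge px /= dE addNb addbN.
Qed.

(** The definition of [lexical] tests only suffixes starting at a cell. A suffix starting inside a
    cell begins with 0 for one sign; for the other it is the word of a tail whose first cell is cut
    down, hence smaller than the tail itself. *)
Lemma lexical_enc a : alpha_seq a -> lexical a = lexw (enc a).
Proof.
move=> /alpha_seqP [-> //|[a0 pa]].
have pd k : pos (drop k a) by move: pa; rewrite -{1}(cat_take_drop k a) all_cat => /andP [].
have sa : size (enc a) = sumn a by rewrite size_runs.
apply/allP/idP => [H|al k].
  have Hk k : 0 < k < size a -> wlt (enc (drop k a)) (enc a).
    move=> ka; rewrite wlt_enc //; have := H k.+1; apply.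
    by rewrite mem_iota; lia.
  apply: lexwI => p s; rewrite sa => /andP [p0]; rewrite leq_eqVlt => /orP [/eqP pE|pl].
    rewrite drop_oversize ?sa ?pE //.
    by case: a a0 pa {H Hk pd sa p0 pE} => // -[].
  have [k [v [ka vk dE k0]]] := drop_runs true pl; rewrite -/(enc a) in dE.
  rewrite dE xw_cat {1}/xw map_nseq -runs_xw addbN.
  have ah : enc a = true :: behead (enc a) by case: (a) a0 pa => // -[].
  case: (s (+) _); last by rewrite ah; case: (v) vk.
  rewrite -[X in wlt X _]/(enc (v :: drop k.+1 a)) wlt_enc //; last first.
    by apply/andP; split; [case/andP: vk|apply: pd].
  have dk := drop_nth 0 ka.
  have [k_0|k_gt0] := posnP k.
    rewrite k_0 drop0 in dk vk k0 *; rewrite {2}dk seq_lt_cons.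
    by case: eqP => [/(k0 erefl) pE|]; lia.
  have := Hk k; rewrite k_gt0 ka wlt_enc // dk => /(_ isT).
  case: (eqVneq v (nth 0 a k)) vk => [-> //|]; move: (nth 0 a k) => m vm /andP [_ vk].
  case: (a) a0 => // x b _; rewrite !seq_lt_cons.
  by case: (eqVneq v x) => [<-|_]; case: eqP; lia.
rewrite mem_iota => kr.
have k1 : 0 < k.-1 <= size a by lia.
rewrite -wlt_enc // enc_drop; last by case/andP: k1.
apply: lexw_tail => //; rewrite sa; apply/andP; split.
  by case: (a) a0 pa k1 => // x b _ /andP [x0 _]; case: k.-1 => //= j _; rewrite ltn_addr.
by rewrite -{2}(cat_take_drop k.-1 a) sumn_cat leq_addr.
Qed.

Lemma mem_L n a :
  (a \in L n) = [&& alpha_seq a, lexw (enc a) & (size (enc a)).+1 == n].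
Proof.
rewrite inE; case al: (alpha_seq a) => //=.
by rewrite lexical_enc // size_runs add1n.
Qed.

Lemma mem_D n a : 0 < n -> (a \in D n) = alpha_seq a && Dw n (enc a).
Proof.
move=> n0; rewrite inE; apply/hasP/andP => [[d]|[al /andP [l dn]]].
  by rewrite mem_L -dvdn_divisors // /Dw => dn /and3P [-> -> /eqP ->].
exists (size (enc a)).+1; first by rewrite -dvdn_divisors.
by rewrite mem_L al l eqxx.
Qed.

Lemma incr_tail_rcons p x : incr_tail (rcons p x) = rcons p x.+1.
Proof.
by rewrite /incr_tail size_rcons /=; elim: p => //= y p ->.
Qed.

Lemma nseq_rcons (T : Type) k (c : T) : nseq k.+1 c = rcons (nseq k c) c.
Proof. by elim: k => //= k ->. Qed.

Lemma runs_rcons b p x : runs b (rcons p x) = runs b p ++ nseq x (b (+) odd (size p)).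
Proof. by rewrite -cats1 runs_cat /= cats0. Qed.

Lemma seq_oP a : a != [::] -> pos a ->
  [/\ pos (seq_o a), enc (seq_o a) = rcons (enc a) true & odd (size (seq_o a))].
Proof.
case/lastP: a => // p x _; rewrite all_rcons => /andP [x0 pp].
rewrite /seq_o size_rcons /=; case: ifP => op.
  rewrite incr_tail_rcons /enc !runs_rcons all_rcons size_rcons (nseq_rcons x) /= op.
  by rewrite rcons_cat.
rewrite /enc !runs_rcons !all_rcons !size_rcons /= x0 pp op.
by rewrite cats1.
Qed.

Lemma seq_eP a : a != [::] -> pos a ->
  [/\ pos (seq_e a), enc (seq_e a) = rcons (enc a) false & ~~ odd (size (seq_e a))].
Proof.
case/lastP: a => // p x _; rewrite all_rcons => /andP [x0 pp].
rewrite /seq_e size_rcons /=; case: ifP => op.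
  rewrite /enc !runs_rcons !all_rcons !size_rcons /= x0 pp (negbTE op).
  by rewrite cats1.
rewrite incr_tail_rcons /enc !runs_rcons all_rcons size_rcons (nseq_rcons x) /=; move/negbFE: op => op.
by rewrite op pp rcons_cat.
Qed.

Definition chunk (a : seq nat) (x : nat) : seq nat :=
  seq_o a ++ flatten (nseq x.-1 (seq_e a)).

Lemma chunkP a x : a != [::] -> pos a -> pos (chunk a x) /\ odd (size (chunk a x)).
Proof.
move=> a0 pa; have [po _ so] := seq_oP a0 pa; have [pe _ se] := seq_eP a0 pa.
rewrite /chunk all_cat size_cat oddD po so; split=> /=.
  by elim: x.-1 => //= y IH; rewrite all_cat pe.
by elim: x.-1 => //= y IH; rewrite size_cat oddD (negbTE se).
Qed.

(** Read from [c], the pieces [seq_o a] and [seq_e a] all end in the letter [c]. Grouping this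
    letter with the copy of a after it turns the cell x into x blocks. *)
Lemma runs_chunk c a x : a != [::] -> pos a -> 0 < x ->
  runs c (chunk a x) ++ xw c (enc a) = xw (~~ c) (enc a) ++ blocks (enc a) (nseq x c).
Proof.
move=> a0 pa; case: x => // x _; rewrite /chunk /=.
have [po eo so] := seq_oP a0 pa; have [pe ee se] := seq_eP a0 pa.
rewrite runs_cat so addbT -catA.
have -> : runs c (seq_o a) = rcons (xw (~~ c) (enc a)) c.
  have -> : runs c (seq_o a) = xw (~~ c) (enc (seq_o a)) by rewrite -runs_xw; case: c.
  by rewrite eo -!cats1 xw_cat; case: c.
rewrite cat_rcons; congr (_ ++ _).
elim: x c => [|x IH] c; first by rewrite /= blocks_cons cats0.
rewrite /= in IH *.
rewrite blocks_cons -IH /=; congr (_ :: _).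
rewrite runs_cat (negbTE se) addbF -catA.
have -> : runs (~~ c) (seq_e a) = xw c (enc (seq_e a)) by rewrite -runs_xw; case: c.
by rewrite ee -cats1 xw_cat -catA /= addbF.
Qed.

(** For a other than (0), b = (0) is excluded: there [star] gives [seq_o a ++ a], whereas the word
    formula gives a. *)
Lemma enc_star a b : alpha_seq a -> alpha_seq b -> a = [:: 0] \/ b != [:: 0] ->
  alpha_seq (star a b) /\ enc (star a b) = wstar (enc a) (enc b).
Proof.
move=> /alpha_seqP [->|[a0 pa]] ab H.
  by rewrite /star eqxx /wstar blocks_nil.
have {H} b0 : b != [:: 0] by case: H => // ea; rewrite ea in pa.
case/alpha_seqP: ab => [eb|[bn pb]]; first by rewrite eb in b0.
have -> : star a b = flatten [seq chunk a x | x <- b] ++ a.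
  by rewrite /star; case: eqP => // ea; rewrite ea in pa.
split.
  apply: alpha_seq_pos; last by rewrite -size_eq0 size_cat addn_eq0 !size_eq0 (negbTE a0) andbF.
  rewrite all_cat pa andbT; elim: (b) => //= x c IH.
  by rewrite all_cat (chunkP x a0 pa).1.
suff H c : runs c (flatten [seq chunk a x | x <- b] ++ a) =
    xw (~~ c) (enc a) ++ blocks (enc a) (runs c b).
  by rewrite /enc H xw_false.
elim: b {bn b0} c pb => [|x b IH] c /=.
  by rewrite cats0 => _; rewrite -runs_xw; case: c.
move=> /andP [x0 pb]; rewrite -catA runs_cat (chunkP x a0 pa).2 addbT IH // negbK.
by rewrite catA runs_chunk // blocks_cat -catA.
Qed.

Lemma harmonicP j a : alpha_seq a ->
  alpha_seq (harmonic j a) /\ enc (harmonic j a) = iter j h1 (enc a).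
Proof.
move=> al; elim: j => //= j [/alpha_seqP [->|[h0 ph]] <-] //.
have [po eo so] := seq_oP h0 ph.
have -> : (harmonic j a == [:: 0]) = false by apply/eqP => e; rewrite e in ph.
split.
  by apply: alpha_seq_pos; rewrite ?all_cat ?po // -size_eq0 size_cat addn_eq0 !size_eq0 (negbTE h0) andbF.
by rewrite /enc runs_cat so -/(enc _) eo cat_rcons runs_false.
Qed.

Definition wh (l : nat) (F : seq bool) : seq bool := iter l h1 F.

Lemma blocks_wstar a g b : blocks (wstar a g) b = blocks a (blocks g b).
Proof.
elim: b => // c b IH; rewrite !blocks_cons IH blocks_cat.
by rewrite /wstar xw_cat -catA xw_blocks.
Qed.

Lemma wstarA a g b : wstar a (wstar g b) = wstar (wstar a g) b.
Proof.
rewrite -[RHS]/(wstar a g ++ blocks (wstar a g) b) blocks_wstar.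
by rewrite /wstar blocks_cat catA.
Qed.

Lemma wstar_wh F l : wstar F (wh l [::]) = wh l F.
Proof.
elim: l => [|l IH]; first by rewrite /wstar cats0.
by rewrite /wh /= -!/(wh _ _) h1_wstar wstarA IH h1_wstar.
Qed.

Lemma lexw_wh l F : lexw F -> lexw (wh l F).
Proof. by move=> Fl; elim: l => //= l; apply: lexw_h1. Qed.

Lemma size_wh l F : (size (wh l F)).+1 = 2 ^ l * (size F).+1.
Proof.
elim: l => [|l IH]; first by rewrite mul1n.
by rewrite [wh _ _]/= size_h1 expnS -mulnA -IH mul2n.
Qed.

Lemma two_exp_half N : 0 < N -> N = 2 ^ two_exp N * (2 * half_odd N + 1).
Proof.
move=> N0; have [m m2 NE] := pfactor_coprime (isT : prime 2) N0.
have om : odd m by rewrite coprime2n in m2.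
have NE' : N = 2 ^ logn 2 N * (2 * m./2 + 1).
  by rewrite {1}NE mulnC addn1 mul2n -[in LHS](odd_double_half m) om.
by have [h1 h2] := two_expE NE'; rewrite {1}NE' h2.
Qed.

Lemma enc_oddw s : enc (2 :: nseq (2 * s) 1) = oddw s.
Proof.
rewrite /enc /= /oddw; congr [:: _, _ & _].
by elim: s => // s IH; rewrite mul2n doubleS /= -mul2n IH.
Qed.

(* The word of f * mu_N, if [F] is that of f.                                  *)
Definition wmu (N : nat) (F : seq bool) : seq bool :=
  let h := wh (two_exp N) F in
  if half_odd N is s.+1 then wstar h (oddw s) else h.

Lemma wstar_wmu F N : wstar F (wmu N [::]) = wmu N F.
Proof.
by rewrite /wmu; case: half_odd => [|s]; rewrite ?wstarA wstar_wh.
Qed.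

Lemma size_wmu N F : 0 < N -> (size (wmu N F)).+1 = N * (size F).+1.
Proof.
move=> N0; rewrite {2}(two_exp_half N0) /wmu; case: half_odd => [|s].
  by rewrite size_wh muln1.
by rewrite size_wstar size_wh /= size_alt; nia.
Qed.

Lemma lexw_wmu N F : lexw F -> lexw (wmu N F).
Proof.
move=> Fl; have hl := lexw_wh (two_exp N) Fl; rewrite /wmu; case: half_odd => // s.
by apply: wstar_lexw => //; apply: oddw_lexw.
Qed.

Lemma muP N : alpha_seq (mu N) /\ enc (mu N) = wmu N [::].
Proof.
have [al e] := harmonicP (two_exp N) (isT : alpha_seq [:: 0]).
rewrite /mu /wmu; case: half_odd => [//|s] /=.
have -> : 2 * (s.+1 - 1) = 2 * s by rewrite subn1.
have ps : alpha_seq (2 :: nseq (2 * s) 1).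
  by apply: alpha_seq_pos => //=; rewrite all_nseq orbT.
have [|a2 e2] := enc_star al ps; first by right.
by rewrite e2 enc_oddw e.
Qed.

(** The case [d = 1] is allowed only for (0), because [mu 1] is (0). *)
Lemma star_muP f d : alpha_seq f -> 1 < d \/ f = [:: 0] ->
  alpha_seq (star f (mu d)) /\ enc (star f (mu d)) = wmu d (enc f).
Proof.
move=> af H; have [am em] := muP d.
have [|a2 ->] := enc_star af am; last by rewrite em wstar_wmu.
case: H => [d1|]; [right|by left]; apply: contraTneq d1 => e0.
have [->|d0] := posnP d => //; have := size_wmu [::] d0; rewrite -em e0 /= muln1.
by move=> <-.
Qed.

(** * Chains of successors *)

Fixpoint nchain (n : nat) (a : seq nat) (s : seq (seq nat)) : Prop :=
  if s is b :: s' then nextw n (enc a) (enc b) /\ nchain n b s' else True.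

Lemma nchain_cat n a s s' :
  nchain n a (s ++ s') <-> nchain n a s /\ nchain n (last a s) s'.
Proof.
elim: s a => [|b s IH] a /=; first by split=> // -[].
by rewrite IH; split=> [[? []]|[[? ?] ?]].
Qed.

Lemma nchain_harmonic n f i k : alpha_seq f -> lexw (enc f) ->
  2 ^ (i + k) * (size (enc f)).+1 %| n ->
  nchain n (harmonic i f) [seq harmonic j f | j <- iota i.+1 k]
  /\ last (harmonic i f) [seq harmonic j f | j <- iota i.+1 k] = harmonic (i + k) f.
Proof.
move=> af lf; elim: k i => [|k IH] i dn; first by rewrite addn0.
have [|c l] := IH i.+1; first by rewrite addSnnS.
rewrite /= -/(harmonic i.+1 f) -addSnnS; split=> //; split=> //.
have [_ ->] := harmonicP i af; have [_ ->] := harmonicP i.+1 af.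
apply: next_h1; first exact: lexw_wh.
rewrite -[iter _ _ _]/(wh i (enc f)) size_wh -mul2n mulnA -expnS.
by apply: dvdn_trans dn; rewrite dvdn_mul // dvdn_exp2l // addnS ltnS leq_addr.
Qed.

(** While [n] divided by the level is even, the successor is the next harmonic, which doubles the
    level. After [two_exp d] doublings the quotient is odd; it is 1, or [next_oddw] reaches level
    [n] at once. *)
Lemma blockP n f d : alpha_seq f -> lexw (enc f) -> 0 < d -> 1 < d \/ f = [:: 0] ->
  n = d * (size (enc f)).+1 ->
  exists b, [/\ block f d = f :: b, nchain n f b, all alpha_seq b
    & last f b = star f (mu d)].
Proof.
move=> af lf d0 H nE; have [as_ es] := star_muP af H.
have dE := two_exp_half d0.
have [|ch lh] := @nchain_harmonic n f 0 (two_exp d) af lf.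
  by rewrite nE dvdn_mul // {2}dE dvdn_mulr.
rewrite /= add0n in ch lh.
have ah : all alpha_seq [seq harmonic j f | j <- iota 1 (two_exp d)].
  by apply/allP => x /mapP [j _ ->]; apply: (harmonicP j af).1.
have [ak ek] := harmonicP (two_exp d) af.
rewrite /block /=; move: es; rewrite /wmu; case hs: half_odd => [|s] es.
  eexists; rewrite cats0; split; [reflexivity| | |] => //.
  by rewrite lh; apply: enc_inj => //; rewrite es ek.
eexists; split; [reflexivity| | |]; last by rewrite last_cat.
  apply/nchain_cat; rewrite lh; split=> //=; split=> //.
  rewrite es ek; apply: next_oddw; first exact: lexw_wh.
  by rewrite -[iter _ _ _]/(wh (two_exp d) (enc f)) size_wh nE {1}dE hs; nia.
by rewrite all_cat ah /= as_.
Qed.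

(** * Elementary operations as flips *)

Lemma wedge_cat p a b : wedge (p ++ a) (p ++ b) = p ++ wedge a b.
Proof. by elim: p => //= x p ->; rewrite eqxx. Qed.

Lemma enc_cons2 y x r : enc (y :: x :: r) = nseq y true ++ nseq x false ++ enc r.
Proof. by []. Qed.

Lemma run_end_cell a q : pos a -> q < size (enc a) -> nth false (enc a) q = false ->
  (q.+1 < size (enc a) -> nth false (enc a) q.+1) ->
  exists i, [/\ ~~ odd i, 0 < i <= size a & q.+1 = sumn (take i a)].
Proof.
have [N] := ubnP (size a); elim: N a q => // N IH [|y [|x r]] q //= sz pa ql.
  by rewrite /enc /= cats0 nth_nseq; move: ql; rewrite size_runs /= addn0 => ->.
case/and3P: pa => y0 x0 pr; rewrite enc_cons2 !nth_cat !size_nseq !nth_nseq.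
rewrite enc_cons2 !size_cat !size_nseq in ql *.
case: (ltnP q y) => // qy; have -> : (q.+1 < y) = false by lia.
case: (ltnP (q - y) x) => qx eq H.
  exists 2; split=> //=; rewrite take0 /=; case: (ltnP (q.+1 - y) x) H => [h|]; last by lia.
  have -> : q.+1 < y + (x + size (enc r)) by lia.
  by move=> /(_ isT).
have [||||i [oi ir qE]] := IH r (q - y - x) _ pr; try by lia.
- move=> h; have := H ltac:(lia); rewrite ifF; last by lia.
  by have -> : q.+1 - y - x = (q - y - x).+1 by lia.
by exists i.+2; rewrite /= negbK; split=> //; lia.
Qed.

(** Splitting makes the last 0 of a run a cell 1 of its own; conjugation joins a single 0, turned
    into 1, to the preceding run. Either way the later cells change parity, so their letters are
    complemented, and the wedge stops just before the changed letter. *)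
Lemma op_cell a i : pos a -> ~~ odd i -> 0 < i <= size a ->
  let q := (sumn (take i a)).-1 in
  exists a', [/\ elementary_op i a = Some a',
    q < size (enc a) /\ nth false (enc a) q = false,
    alpha_seq a' /\ enc a' = flipw (enc a) q
    & alpha_seq (wedge a a') /\ enc (wedge a a') = take q (enc a)].
Proof.
move=> pa oi ia q.
have [p [y [x [r [aE sp]]]]] : exists p y x r, a = p ++ y :: x :: r /\ i = (size p).+2.
  exists (take i.-2 a), (nth 0 a i.-2), (nth 0 a i.-1), (drop i a).
  have i2 : 1 < i by case: (i) oi ia => [|[]].
  split; last by rewrite size_takel; lia.
  rewrite -{1}(cat_take_drop i.-2 a) (drop_nth 0); last by lia.
  have -> : i.-2.+1 = i.-1 by lia.
  rewrite (drop_nth 0); last by lia.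
  by have -> : i.-1.+1 = i by lia.
have op : odd (size p) = false by move: oi; rewrite sp /= negbK => /negbTE.
have et t : enc (p ++ t) = enc p ++ enc t by rewrite /enc runs_cat op addbF.
have qE : q = size (enc p) + (y + x.-1).
  have : 0 < x by move: pa; rewrite aE all_cat /= => /and4P [].
  rewrite /q aE sp -cat_rcons -cat_rcons take_size_cat ?size_rcons //.
  rewrite -!cats1 !sumn_cat /= size_runs; lia.
have := pa; rewrite {1}aE all_cat => /andP [pp] /= /and3P [y0 x0 pr].
have encE : enc a = (enc p ++ nseq y true ++ nseq x.-1 false) ++ false :: enc r.
  rewrite aE et enc_cons2 -{1}(prednK x0) nseq_rcons -cats1 -!catA //.
have tq : take q (enc a) = enc p ++ nseq y true ++ nseq x.-1 false.
  by rewrite encE take_size_cat // qE !size_cat !size_nseq.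
have sq : q = size (enc p ++ nseq y true ++ nseq x.-1 false).
  by rewrite qE !size_cat !size_nseq.
have fl : flipw (enc a) q = enc p ++ nseq y true ++ nseq x.-1 false ++ true :: runs false r.
  rewrite /flipw tq encE -[in drop _ _]cat_rcons drop_size_cat ?size_rcons ?sq //.
  by rewrite -runs_false -!catA.
have q1 : q < size (enc a) by rewrite encE size_cat -sq /= addnS ltnS leq_addr.
have q2 : nth false (enc a) q = false by rewrite encE nth_cat sq ltnn subnn.
have nx : nth 0 a i.-1 = x by rewrite aE sp /= nth_cat ltnNge leqnSn subSnn.
have tk : take i.-1 a = rcons p y.
  by rewrite aE sp /= -cat_rcons take_size_cat ?size_rcons.
have dr : drop i a = r.
  by rewrite aE sp /= -cat_rcons -cat_rcons drop_size_cat ?size_rcons.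
rewrite /elementary_op nx tk dr.
case: (ltnP 1 x) => x1.
  have -> : 0 < i by case/andP: ia.
  exists (rcons p y ++ [:: x.-1; 1] ++ r); rewrite cat_rcons; split=> //.
    split; first by apply: alpha_seq_pos; rewrite ?all_cat /= ?pp ?y0 ?pr ?andbT; [lia|case: (p)].
    by rewrite et enc_cons2 fl.
  have -> : wedge a (p ++ y :: [:: x.-1; 1] ++ r) = p ++ [:: y; x.-1].
    by rewrite aE wedge_cat /= eqxx; case: eqP => [|_]; [lia|rewrite (minn_idPr _) // leq_pred].
  split; first by apply: alpha_seq_pos; rewrite ?all_cat /= ?pp ?y0 ?andbT; [lia|case: (p)].
  by rewrite et tq /enc /= cats0.
have {x1} x1 : x = 1 by lia.
rewrite andbF x1 eqxx andbT; have -> : 1 < i by rewrite sp.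
have ir : incr_nth (rcons p y) i.-2 = rcons p y.+1.
  by rewrite -incr_tail_rcons /incr_tail size_rcons sp.
exists (rcons p y.+1 ++ r); rewrite ir cat_rcons; split=> //.
  split; first by apply: alpha_seq_pos; rewrite ?all_cat /= ?pp ?pr //; case: (p).
  by rewrite et fl x1 /= /enc [runs true (_ :: _)]/= -[true :: _]/(nseq y.+1 true ++ _) nseq_rcons cat_rcons.
have -> : wedge a (p ++ y.+1 :: r) = p ++ [:: y].
  by rewrite aE wedge_cat /=; case: eqP => [|_]; [lia|rewrite (minn_idPl _)].
split; first by apply: alpha_seq_pos; rewrite ?all_cat /= ?pp ?y0 //; case: (p).
by rewrite et tq x1 /enc /= cats0.
Qed.

Lemma last_filter_iota (P : pred nat) i n : 0 < i <= n -> P i ->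
  (forall j, i < j <= n -> ~~ P j) -> last 0 [seq j <- iota 1 n | P j] = i.
Proof.
case: i => // i /= le Pi H.
have -> : n = i + (n - i.+1).+1 by lia.
rewrite iotaD filter_cat last_cat /= add1n Pi /=.
suff -> : [seq j <- iota i.+2 (n - i.+1) | P j] = [::] by [].
apply/eqP; rewrite -size_eq0 size_filter eqn0Ngt -has_count; apply/hasPn => j.
by rewrite mem_iota => jr; apply: H; lia.
Qed.

(** The last letters of even cells come in the order of the cells, so the last admissible flip
    belongs to the largest admissible even cell. *)
Lemma active_cellP n a q : a \in L n -> pos a -> q < size (enc a) ->
  nth false (enc a) q = false -> lexw (flipw (enc a) q) ->
  (forall q', q < q' < size (enc a) -> nth false (enc a) q' = false ->
     ~~ lexw (flipw (enc a) q')) ->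
  exists a', [/\ elementary_op (active_cell n a) a = Some a', a' \in L n,
    enc a' = flipw (enc a) q, alpha_seq (wedge a a') & enc (wedge a a') = take q (enc a)].
Proof.
rewrite mem_L => /and3P [al la /eqP sa] pa qs aq lq H.
have [i [oi ia qE]] := run_end_cell pa qs aq (fun h => next_up_cell la h aq lq H).
have [a' [op _ [al' e'] [alw ew]]] := op_cell pa oi ia.
rewrite -qE /= in e' ew.
have a'L : a' \in L n by rewrite mem_L al' e' lq size_flipw // sa /=.
suff -> : active_cell n a = i by exists a'.
apply: last_filter_iota => //=; first by rewrite oi op.
move=> j /andP [ij js]; apply/negP=> /andP [oj].
have ja : 0 < j <= size a by rewrite js (leq_ltn_trans _ ij).
have [b [-> [q's bq] [_ eb] _]] := op_cell pa oj ja.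
rewrite /= mem_L => /and3P [_ lb _]; move: lb; rewrite eb; apply/negP/H => //.
rewrite q's andbT; suff : sumn (take i a) < sumn (take j a) by rewrite -qE; case: sumn.
rewrite -(subnKC (ltnW ij)) takeD sumn_cat -addn1 leq_add2l.
have : 0 < j - i by rewrite subn_gt0.
have : drop i a != [::] by rewrite -size_eq0 size_drop -lt0n subn_gt0 (leq_trans ij).
have : pos (drop i a) by move: pa; rewrite -{1}(cat_take_drop i a) all_cat => /andP [].
case: (drop i a) => // z c /= /andP [z0 _] _; case: (j - i) => //= u _.
by rewrite ltn_addr.
Qed.

Lemma enc1 k : enc [:: k] = nseq k true.
Proof. by rewrite /enc /= cats0. Qed.

Lemma wlt_top w k : size w <= k -> w = nseq k true \/ wlt w (nseq k true).
Proof.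
elim: w k => [|c w IH] [|k] //=; [by left|by right|].
by move=> /IH; case: c => -[->|]; [left|right|right|right].
Qed.

Lemma alpha_seq1 k : alpha_seq [:: k].
Proof. by case: k. Qed.

Lemma mem_D1 n : 0 < n -> [:: n.-1] \in D n.
Proof.
move=> n0; rewrite mem_D // alpha_seq1 /Dw -lexical_enc ?alpha_seq1 //=.
by rewrite size_runs /= addn0 prednK.
Qed.

Lemma D_top n b : 0 < n -> b \in D n -> b <> [:: n.-1] ->
  wlt (enc b) (enc [:: n.-1]).
Proof.
move=> n0; rewrite mem_D // => /andP [al Db] bn.
have /wlt_top [e|] : size (enc b) <= n.-1.
  by case/andP: Db => _ /dvdn_leq; lia.
- by case: bn; apply: enc_inj; rewrite ?alpha_seq1 // enc1.
- by rewrite enc1.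
Qed.

Lemma L_sub_D n a : a \in L n -> a \in D n.
Proof.
rewrite mem_L => /and3P [al l /eqP sa].
by rewrite mem_D -?sa // /Dw al l dvdnn.
Qed.

(** * The procedure *)

Definition inv (n : nat) (st : state) : Prop :=
  st.2 \in L n /\ exists s, [/\ st.1 = [:: 0] :: s, nchain n [:: 0] s,
    all alpha_seq s & last [:: 0] s = st.2].

Lemma inv_start n : 0 < n -> inv n (start n).
Proof.
move=> n0; have [am em] := muP n.
have [||s [bE ch al ls]] := @blockP n [:: 0] n isT isT n0; first by right.
  by rewrite muln1.
split; last by exists s; split; rewrite /= ?bE.
by rewrite mem_L /= am em lexw_wmu //= size_wmu //= muln1.
Qed.

(** The wedge has level [q.+1], so the two cases of (c) are those of [next_up]: the flip is the
    successor, or the wedge is and opens a block. *)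
Lemma inv_step n st : 0 < n -> inv n st -> st.2 <> [:: n.-1] ->
  exists st', [/\ step n st = Some st', inv n st' & size st.1 < size st'.1].
Proof.
case: st => str a n0 [/= aL [s [-> ch al ls]]] an.
have aD := L_sub_D aL; have := aL; rewrite mem_L => /and3P [aa la /eqP sa].
have [pa n1] : pos a /\ 1 < n.
  case/alpha_seqP: aa an sa => [-> /=|[a0 pa] _ <-]; first by case: (n) => [|[]].
  by split=> //; case: (a) a0 pa => // -[].
have [x nx] : exists x, nextw n (enc a) x.
  apply: (next_exists n0 (y := enc [:: n.-1])); last exact: D_top.
  - by have := aD; rewrite mem_D // => /andP [].
  - by have := mem_D1 n0; rewrite mem_D // => /andP [].
have sa' : size (enc a) = n.-1 by rewrite -sa.
have [q [qs aq [lq lt] xE H]] := next_up n1 sa' nx.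
have [a' [oE a'L e' af ef]] := active_cellP aL pa qs aq lq H.
have sf : 1 + sumn (wedge a a') = q.+1.
  by rewrite -(size_runs true) -/(enc _) ef size_takel // ltnW.
have fL : wedge a a' \in L q.+1 by rewrite mem_L af ef lt size_takel ?eqxx // ltnW.
rewrite /step; case: eqP => // _; rewrite oE sf fL /= lt0n -/(dvdn _ _).
case: ifP => dn.
  eexists; split; [reflexivity| |by rewrite /= size_rcons].
  split=> //; exists (rcons s a'); rewrite last_rcons; split=> //.
    rewrite -cats1; apply/nchain_cat; rewrite ls; split=> //=; split=> //.
    by rewrite e'; rewrite (negbTE dn) in xE; rewrite -xE.
  by rewrite all_rcons al andbT; move: a'L; rewrite mem_L => /and3P [].
move/negbFE: dn => dn; rewrite dn -ef in xE; rewrite xE in nx.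
have qn : q.+1 < n by rewrite -sa ltnS.
have d1 : 1 < n %/ q.+1 by rewrite ltn_divRL // mul1n.
have nE : n = n %/ q.+1 * (size (enc (wedge a a'))).+1.
  by rewrite ef size_takel ?divnK // ltnW.
have lf : lexw (enc (wedge a a')) by rewrite ef.
have [|b [bE chb alb lb]] := blockP af lf (ltnW d1) _ nE; first by left.
have [|af2 ef2] := @star_muP (wedge a a') (n %/ q.+1) af; first by left.
eexists; split; [reflexivity| |by rewrite /= bE size_cat /= addnS !ltnS leq_addr].
split=> /=; first by rewrite mem_L af2 ef2 lexw_wmu //= size_wmu -?nE // ltnW.
exists (s ++ wedge a a' :: b); rewrite bE last_cat; split=> //.
  by apply/nchain_cat; rewrite ls.
by rewrite all_cat al /= af.
Qed.

Lemma nchain_D n a s : nchain n a s -> all alpha_seq s -> a \in D n -> 0 < n ->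
  {subset a :: s <= D n}.
Proof.
move=> ch al aD n0; elim: s a ch al aD => [|b s IH] a /=.
  by move=> _ _ aD x; rewrite inE => /eqP ->.
move=> [[_ Db _ _] ch] /andP [ab al] aD x; rewrite inE => /orP [/eqP -> //|].
by apply: IH => //; rewrite mem_D // ab.
Qed.

Definition enc_lt (a b : seq nat) : bool := wlt (enc a) (enc b).

Lemma enc_lt_trans : transitive enc_lt.
Proof. by move=> y x z; apply: wlt_trans. Qed.

Lemma nchain_path n a s : nchain n a s -> path enc_lt a s.
Proof. by elim: s a => //= b s IH a [[_ _ ab _] /IH ->]; rewrite /enc_lt ab. Qed.

(** A strictly increasing string has no repetition; this bound makes the procedure end in
    [run_ends]. *)
Lemma inv_size n st : 0 < n -> inv n st -> size st.1 <= size (words n).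
Proof.
move=> n0 [_ [s [-> ch al ls]]].
rewrite -(size_map enc); apply: uniq_leq_size.
  apply: (@sorted_uniq _ wlt); [exact: wlt_trans|exact: wlt_irr|].
  by rewrite sorted_map; exact: nchain_path ch.
move=> w /mapP [x xs ->]; apply: mem_words.
have z : [:: 0] \in D n by rewrite mem_D //= /Dw /= dvd1n.
have := nchain_D ch al z n0 xs; rewrite mem_D // => /andP [_ Dx].
exact/ltnW/Dw_size.
Qed.

Lemma run_ends n st : 0 < n -> inv n st -> exists N st',
  [/\ iter N (obind (step n)) (Some st) = Some st', inv n st' & st'.2 = [:: n.-1]].
Proof.
move=> n0; have [M] := ubnP (size (words n) - size st.1); elim: M st => // M IH st sz iv.
case: (eqVneq st.2 [:: n.-1]) => [e|/eqP e]; first by exists 0, st.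
have [st1 [sE iv1 s1]] := inv_step n0 iv e.
have [|N [st2 [rE iv2 e2]]] := IH st1 _ iv1; first by have := inv_size n0 iv1; lia.
by exists N.+1, st2; rewrite iterSr /= sE.
Qed.

Lemma nchain_mem n a s y : nchain n a s -> all alpha_seq (a :: s) -> 0 < n ->
  last a s = [:: n.-1] -> y \in D n -> y = a \/ enc_lt a y -> y \in a :: s.
Proof.
move=> ch al n0 ls yD; elim: s a ch al ls => [|b s IH] a /= ch al ls.
  case=> [->|]; first by rewrite mem_head.
  rewrite ls mem_seq1 => /(wlt_asym) h; apply/negPn/negP=> /eqP /(D_top n0 yD) //.
case=> [->|ay]; first by rewrite mem_head.
case: ch => [[_ _ _ gap] ch]; case/andP: al => aa al.
have := yD; rewrite mem_D // => /andP [ya Dy]; have /andP [ba _] := al.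
rewrite inE (IH b) ?orbT //; case: (wlt_total (enc y) (enc b)) => [e|h|h].
- by left; apply: enc_inj.
- by case: (gap (enc y)).
- by right.
Qed.

Lemma nchain_nth n a s i : nchain n a s -> i < size s ->
  nextw n (enc (nth [::] (a :: s) i)) (enc (nth [::] s i)).
Proof. by elim: s a i => // b s IH a [|i] [h1 h2] //= /IH; apply. Qed.

Theorem mainTheorem4 (n : nat) (hn : 1 <= n) :
  maximal_in (D n) [:: n.-1] /\
  exists (N : nat) (str : seq (seq nat)),
    [/\ run n N = Some (str, [:: n.-1]),
        last [::] str = [:: n.-1],
        str =i D n,
        pairwise seq_lt str
      & forall i : nat, i.+1 < size str ->
          adjacent_in (D n) (nth [::] str i) (nth [::] str i.+1)].
Proof.
split.
  split=> [|b bD bn]; first exact: mem_D1.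
  have := bD; rewrite mem_D // => /andP [ba _].
  by rewrite -wlt_alpha ?alpha_seq1 //; apply: D_top.
have [N [[str a] [rE [_ [s [/= eS ch al ls]]] /= ea]]] := run_ends hn (inv_start hn).
rewrite {}eS {}ea in rE ls; exists N, ([:: 0] :: s).
have z : [:: 0] \in D n by rewrite mem_D //= /Dw /= dvd1n.
have sub := nchain_D ch al z hn.
have al' : all alpha_seq ([:: 0] :: s) by [].
have eqv : {in alpha_seq &, subrel enc_lt seq_lt}.
  by move=> x y ax ay; rewrite /enc_lt wlt_alpha.
split=> //.
- move=> y; apply/idP/idP => [|yD]; first exact: sub.
  apply: (nchain_mem ch) => //; have := yD; rewrite mem_D // => /andP [ya /andP [yl _]].
  case: (eqVneq y [:: 0]) => [|y0]; [by left|right].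
  (* The word of (0) is empty, hence below every other lexical word, as these start with 1. *)
  have : enc y != [::] by apply: contra y0 => /eqP e; apply/eqP/enc_inj.
  by rewrite /enc_lt; case: (enc y) yl => // c w /lexw_head h /h /= ->.
- apply: (sub_in_pairwise eqv) => //; rewrite -sorted_pairwise; last exact: enc_lt_trans.
  exact: nchain_path ch.
move=> i /=; rewrite ltnS => is_; have [_ _ lt gap] := nchain_nth ch is_.
have a1 : alpha_seq (nth [::] ([:: 0] :: s) i) by apply: (allP al'); rewrite mem_nth // ltnW.
have a2 : alpha_seq (nth [::] s i) by apply: (allP al); rewrite mem_nth.
split; first by rewrite -wlt_alpha.
case=> c [cD]; have := cD; rewrite mem_D // => /andP [ca Dc].
by rewrite -!wlt_alpha //; apply: gap.
Qed.
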